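(* Let $\mathcal{A}$ be the disc algebra. Then every element of $\mathrm{SL}_2(\mathcal{A})$ is a product of two exponentials, i.e. for every $A \in \mathrm{SL}_2(\mathcal{A})$ there exist $2\times 2$ matrices $B, C$ with entries in $\mathcal{A}$ and with trace zero such that $A=\exp(B)\exp(C)$.
   Context: The disc algebra $\mathcal{A}$ is the $\mathbb{C}$-Banach algebra of continuous functions $\{z\in\mathbb{C}: |z|\le 1\}\to\mathbb{C}$ that are holomorphic on the interior $\{|z|<1\}$, with pointwise operations and the supremum norm. $\mathrm{SL}_2(\mathcal{A})$ is the group of $2\times2$ matrices with entries in $\mathcal{A}$ and determinant $1$. The exponential of a matrix $B$ with entries in $\mathcal{A}$ is $\exp(B)=\sum_{n\ge 0} B^n/n!$, equivalently the pointwise matrix exponential $z\mapsto \exp(B(z))$. *)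

(* Defs.v *)
From HB Require Import structures.
From mathcomp Require Import all_boot all_order all_algebra.
From mathcomp.real_closed Require Import complex.
From mathcomp Require Import all_classical all_reals all_analysis.

Set Implicit Arguments.
Unset Strict Implicit.
Unset Printing Implicit Defensive.

Import Order.TTheory GRing.Theory Num.Theory.
Import numFieldNormedType.Exports.

Local Open Scope classical_set_scope.
Local Open Scope ring_scope.
Local Open Scope complex_scope.

(* MathComp's standard norm and topology exist on the regular module K^o of a
   numFieldType K, but not on the concrete type R[i]. *)
HB.instance Definition _ (R : realType) := NormedModule.copy R[i] R[i]^o.

Definition closed_disc (R : realType) := {z : R[i] | `|z| <= 1}.

HB.instance Definition _ (R : realType) := Choice.on (closed_disc R).

Fact closed_disc0_subproof (R : realType) : `|0 : R[i]| <= 1.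
Proof. by rewrite normr0 ler01. Qed.

HB.instance Definition _ (R : realType) := isPointed.Build (closed_disc R)
  (exist (fun z : R[i] => `|z| <= 1) 0 (@closed_disc0_subproof R)).

(* Extension by zero; only used through its values on the closed disc, where the
   library's {within _, continuous _} and derivable apply to it. *)
Definition disc_ext (R : realType) (f : closed_disc R -> R[i])
    (w : R[i]) : R[i] :=
  oapp f 0 (insub w).

(* R[i] is a module over itself, so derivable in the direction 1 means that the
   complex difference quotient has a limit in R[i]. *)
Definition in_disc_algebra (R : realType) (f : closed_disc R -> R[i]) : Prop :=
  {within [set z : R[i] | `|z| <= 1], continuous (disc_ext f)} /\
  (forall z : R[i], `|z| < 1 -> derivable (disc_ext f) z 1).

Definition disc_algebra_pred (R : realType) : {pred closed_disc R -> R[i]} :=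
  fun f => `[< in_disc_algebra f >].

Section disc_algebra_closed.
Variable R : realType.
Local Notation C := R[i].
Implicit Types f g : closed_disc R -> C.

Lemma disc_extE f (u : closed_disc R) : disc_ext f (val u) = f u.
Proof. by rewrite /disc_ext valK. Qed.

Lemma disc_extB f g : disc_ext (f - g) = disc_ext f - disc_ext g.
Proof.
by apply/funext => w; rewrite /disc_ext !fctE; case: insub => //=; rewrite subr0.
Qed.

Lemma disc_extM f g : disc_ext (f * g) = disc_ext f * disc_ext g.
Proof.
by apply/funext => w; rewrite /disc_ext !fctE; case: insub => //=; rewrite mulr0.
Qed.

Lemma disc_ext_cst (c w : C) : `|w| <= 1 ->
  disc_ext (cst c : closed_disc R -> C) w = c.
Proof. by move=> w1; rewrite /disc_ext insubT. Qed.

Lemma near_dist (z e : C) : 0 < e -> \forall w \near z, `|z - w| < e.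
Proof. by have /cvgrPdist_lt := @cvg_id _ (nbhs z); apply. Qed.

Lemma near_open_disc (z : C) : `|z| < 1 -> \forall w \near z, `|w| < 1.
Proof.
rewrite -subr_gt0 => /(near_dist z).
apply: filterS => w; rewrite ltrBrDl distrC; apply: le_lt_trans.
by rewrite -{1}(subrK z w) addrC ler_normD.
Qed.

Lemma in_disc_algebra_cst c : in_disc_algebra (cst c : closed_disc R -> C).
Proof.
split=> [|z z1].
  apply: (@subspace_eq_continuous _ _ _ (cst c)).
    by move=> w /set_mem/= w1; rewrite /from_subspace disc_ext_cst.
  exact: cst_continuous.
apply: (@near_eq_derivable _ _ _ (cst c)); last exact: derivable_cst.
apply: filterS (near_open_disc z1) => w w1.
by rewrite disc_ext_cst // ltW.
Qed.

Lemma in_disc_algebraB f g :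
  in_disc_algebra f -> in_disc_algebra g -> in_disc_algebra (f - g).
Proof.
move=> [cf df] [cg dg]; rewrite /in_disc_algebra disc_extB; split=> [|z z1].
  exact: (within_continuousB cf cg).
exact: (derivableB (df z z1) (dg z z1)).
Qed.

Lemma in_disc_algebraM f g :
  in_disc_algebra f -> in_disc_algebra g -> in_disc_algebra (f * g).
Proof.
move=> [cf df] [cg dg]; rewrite /in_disc_algebra disc_extM; split=> [|z z1].
  by move=> z; exact: (cvgM (cf z) (cg z)).
exact: (derivableM (df z z1) (dg z z1)).
Qed.

Fact disc_algebra_subring : subring_closed (@disc_algebra_pred R).
Proof.
split=> [|f g /asboolP Af /asboolP Ag|f g /asboolP Af /asboolP Ag];
  apply/asboolP.
- exact: (in_disc_algebra_cst 1).
- exact: in_disc_algebraB.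
- exact: in_disc_algebraM.
Qed.

Fact disc_algebra_scaler : scaler_closed (@disc_algebra_pred R).
Proof.
move=> c f /asboolP Af; apply/asboolP.
exact: (in_disc_algebraM (in_disc_algebra_cst c) Af).
Qed.

End disc_algebra_closed.

HB.instance Definition _ (R : realType) :=
  GRing.isSubringClosed.Build (closed_disc R -> R[i]) (@disc_algebra_pred R)
    (@disc_algebra_subring R).
HB.instance Definition _ (R : realType) :=
  GRing.isScaleClosed.Build R[i] (closed_disc R -> R[i]) (@disc_algebra_pred R)
    (@disc_algebra_scaler R).

Record disc_algebra (R : realType) := DiscAlgebra {
  disc_fun :> closed_disc R -> R[i] ;
  disc_funP : disc_fun \in @disc_algebra_pred R }.

HB.instance Definition _ (R : realType) := [isSub for @disc_fun R].
HB.instance Definition _ (R : realType) := [Choice of disc_algebra R by <:].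
HB.instance Definition _ (R : realType) :=
  [SubChoice_isSubComNzRing of disc_algebra R by <:].
HB.instance Definition _ (R : realType) :=
  [SubZmodule_isSubLmodule of disc_algebra R by <:].

Fact disc_algebra_scalerAl (R : realType) (c : R[i]) (f g : disc_algebra R) :
  c *: (f * g) = (c *: f) * g.
Proof. by apply/val_inj/funext => z; exact: (mulrA c (f z) (g z)). Qed.

HB.instance Definition _ (R : realType) :=
  GRing.Lmodule_isLalgebra.Build R[i] (disc_algebra R)
    (@disc_algebra_scalerAl R).
HB.instance Definition _ (R : realType) :=
  GRing.Lalgebra_isComAlgebra.Build R[i] (disc_algebra R).

Definition sup_norm (R : realType) (f : disc_algebra R) : R :=
  sup (range (fun z => complex.Re `|f z|)).

Section sup_norm.
Variable R : realType.
Local Notation C := R[i].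
Implicit Types f g : disc_algebra R.

Let Renorm (z : C) : (complex.Re `|z|)%:C = `|z|.
Proof. by rewrite normc_def. Qed.

Let norm_real (a : R) : `|a%:C| = `|a|%:C.
Proof. by rewrite normc_def/= expr0n/= addr0 sqrtr_sqr. Qed.

Lemma Re_norm_continuous : continuous (fun z : C => complex.Re `|z| : R).
Proof.
move=> z; apply: (cvgrPdist_lt (F := nbhs z) _ _).2 => e e0.
have /(near_dist z) : 0 < e%:C by rewrite ltcR.
apply: filterS => w zw; rewrite -ltcR; apply: le_lt_trans zw.
rewrite -norm_real rmorphB/= !Renorm.
exact: ler_dist_dist.
Qed.

Let cplx_subE (a b c d : R) :
  (a +i* b) - (c +i* d) = (a - c)%:C + 'i * (b - d)%:C :> C.
Proof. by apply/eqP; rewrite eq_complex/=; rewrite !(mul0r, mulr0, mul1r, oppr0, add0r, addr0) !eqxx. Qed.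

Lemma complex_continuous : continuous (fun p : R * R => p.1 +i* p.2 : C).
Proof.
move=> p; apply: (cvgrPdist_lt (F := nbhs p) _ _).2 => e e0.
have /[!ltcE]/= /andP[/eqP ie re] := e0.
have re2 : 0 < complex.Re e / 2 by rewrite divr_gt0.
near=> q.
rewrite cplx_subE.
apply: (le_lt_trans (ler_normD _ _)).
rewrite normrM !norm_real normc_def/= expr0n/= expr1n add0r sqrtr1 mul1r.
rewrite -rmorphD ltcE/= ie eqxx/= [ltRHS]splitr ltrD//.
  by near: q; apply: cvgr_dist_lt => //; exact: cvg_fst.
by near: q; apply: cvgr_dist_lt => //; exact: cvg_snd.
Unshelve. all: by end_near. Qed.

Lemma closed_disc_compact : compact [set z : C | `|z| <= 1].
Proof.
have Kc : compact ((fun p : R * R => p.1 +i* p.2 : C) @`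
    (`[-1, 1] `*` `[-1, 1])).
  apply: continuous_compact; last by apply: compact_setX; exact: segment_compact.
  by apply: continuous_subspaceT; exact: complex_continuous.
apply: subclosed_compact Kc _.
  rewrite (_ : [set _ | _] =
    (fun z : C => complex.Re `|z|) @^-1` [set x | x <= 1]); last first.
    by apply/seteqP; split=> z/=; rewrite -lecR Renorm.
  apply: closed_comp; last exact: closed_le.
  by move=> z _; exact: Re_norm_continuous.
move=> [a b]/= ab1; exists (a, b) => //=; split; rewrite /= in_itv/= -ler_norml.
  by rewrite -lecR; apply: le_trans ab1; exact: (normc_ge_Re (a +i* b)).
rewrite -lecR; apply: le_trans ab1.
rewrite [leRHS](_ : _ = `|b +i* a|); first exact: (normc_ge_Re (b +i* a)).
by rewrite !normc_def/= addrC.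
Qed.

Lemma has_sup_norm f : has_sup (range (fun z => complex.Re `|f z|)).
Proof.
split; first by exists (complex.Re `|f point|), point.
have /asboolP[cf _] := disc_funP f.
have cg : {within [set z : C | `|z| <= 1],
    continuous (fun z => complex.Re `|disc_ext f z| : R)}.
  move=> z; apply: (continuous_comp (cf z)); exact: Re_norm_continuous.
have [c _ fc] := compact_EVT_max (ex_intro _ 0 (@closed_disc0_subproof R))
  closed_disc_compact cg.
exists (complex.Re `|disc_ext f c|) => _ [z _ <-].
rewrite -(disc_extE f); apply: fc; apply/mem_set; exact: (valP z).
Qed.

Lemma sup_norm_ub f z : complex.Re `|f z| <= sup_norm f.
Proof. by apply: (ub_le_sup (has_sup_norm f).2); exists z. Qed.

Lemma sup_norm_le f (M : R) : (forall z, complex.Re `|f z| <= M) ->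
  sup_norm f <= M.
Proof.
by move=> fM; apply: ge_sup (has_sup_norm f).1 _ => _ [z _ <-].
Qed.

Let ReM (x y : C) : complex.Re `|x * y| = complex.Re `|x| * complex.Re `|y|.
Proof. by rewrite normrM -(Renorm x) -(Renorm y) -rmorphM. Qed.

Let Re_ge0 (x : C) : 0 <= complex.Re `|x|.
Proof. by rewrite -lecR Renorm; exact: (normr_ge0 x). Qed.

Lemma sup_normZ_le (c : C) f :
  sup_norm (c *: f) <= complex.Re `|c| * sup_norm f.
Proof.
apply: sup_norm_le => z.
by rewrite -[leLHS]/(complex.Re `|c * f z|) ReM ler_wpM2l// sup_norm_ub.
Qed.

(* The norm of a normedModType over K takes values in K, here R[i]. *)
Definition disc_norm f : C := (sup_norm f)%:C.

Fact ler_disc_normD f g : disc_norm (f + g) <= disc_norm f + disc_norm g.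
Proof.
rewrite -rmorphD lecR; apply: sup_norm_le => z.
apply: (@le_trans _ _ (complex.Re `|f z| + complex.Re `|g z|)).
  by rewrite -lecR rmorphD/= !Renorm; exact: (ler_normD (f z) (g z)).
by rewrite lerD// sup_norm_ub.
Qed.

Fact disc_norm0_eq0 f : disc_norm f = 0 -> f = 0.
Proof.
move=> [f0]; apply/val_inj/funext => z; apply/eqP.
by rewrite -normr_eq0 -Renorm eq_complex/= eqxx andbT eq_le Re_ge0 -[leRHS]f0
  sup_norm_ub.
Qed.

Fact disc_normZ (c : C) f : disc_norm (c *: f) = `|c| * disc_norm f.
Proof.
rewrite /disc_norm -[`|c|]Renorm -rmorphM; congr (_ %:C).
apply/eqP; rewrite eq_le sup_normZ_le andTb.
have [c0|c0] := eqVneq c 0.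
  have -> : complex.Re `|c| = 0 by rewrite c0 normr0.
  rewrite mul0r; apply: le_trans (sup_norm_ub _ point); exact: Re_ge0.
rewrite -ler_pdivlMl; last by rewrite lt_neqAle Re_ge0 andbT eq_sym;
  apply: contra c0 => /eqP c0; rewrite -normr_eq0 -Renorm c0.
rewrite -{1}[f](scalerK c0); apply: le_trans (sup_normZ_le _ _) _.
apply: ler_wpM2r.
  by apply: le_trans (sup_norm_ub _ point); exact: Re_ge0.
by rewrite -lecR Renorm normfV fmorphV/= Renorm.
Qed.

End sup_norm.

HB.instance Definition _ (R : realType) :=
  Lmodule_isNormed.Build R[i] (disc_algebra R)
    (@ler_disc_normD R) (@disc_normZ R) (@disc_norm0_eq0 R).

(* The limit is taken entrywise for the supremum norm (the matrix topology over
   the normed module disc_algebra R); a%:A is the constant function a. Should the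
   series diverge, limn would return a default value; since disc_algebra R is a
   Banach algebra, that case does not occur. *)
Definition mexp (R : realType) (n : nat) (B : 'M[disc_algebra R]_n.+1) :
    'M[disc_algebra R]_n.+1 :=
  limn [series (k`!%:R^-1 : R[i])%:A *: B ^+ k]_k.

(* Main.v *)
Require Import Defs.
From HB Require Import structures.
From mathcomp Require Import all_boot all_order all_algebra.
From mathcomp.real_closed Require Import complex.
From mathcomp Require Import all_classical all_reals all_analysis.
From mathcomp Require Import ring lra.

Set Implicit Arguments.
Unset Strict Implicit.
Unset Printing Implicit Defensive.

Import Order.TTheory GRing.Theory Num.Theory.
Import numFieldNormedType.Exports.

Local Open Scope classical_set_scope.
Local Open Scope ring_scope.
Local Open Scope complex_scope.

(** Every matrix [M] of determinant 1 over the disc algebra is conjugate, by a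
    shear, to one whose upper left entry is an exponential [e^f]. Such a matrix is
    a lower triangular matrix with diagonal [e^t, e^-t] times an upper triangular
    one with diagonal [e^(f-t), e^(t-f)], for any constant [t]
    ([triangular_factorization]). When [t] is a positive real number larger than
    the supremum of [Re f], the exponents [t] and [f - t] have nonvanishing real
    parts, so in each factor the difference of the eigenvalues is a unit; both
    factors are then diagonalizable over the disc algebra and are exponentials
    ([mexp_conj_lower], [mexp_conj_upper], [mexp_diagonalizable]).

    The shear exists because the disc algebra has stable rank one, in a form where
    units are exponentials ([exp_mod_unimodular]): if [a d - b c = 1] then
    [a = e^f + y c] for some [f] and [y]. The set of elements that are
    exponentials modulo [c] is stable under products, and a small perturbation of
    [a] only multiplies [a] by an exponential modulo [c]. Since polynomials are
    dense, [a] may be taken to be a product of linear factors [z - al], where [al]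
    is not a zero of [c] in the closed disc. Such a factor is an exponential when
    [al] lies outside the disc. Being an exponential modulo [c] does not change
    when [al] moves a little inside the open disc, away from the zeros of [c]
    ([exp_mod_lin_interior]), and it holds for [al] near every point of the unit
    circle where [c] does not vanish ([exp_mod_lin_boundary]). If it failed for
    some [al], then [c] restricted to the open set of these bad [al], and
    extended by zero, would be continuous on the closed disc, zero on the circle
    and nonzero somewhere, against the maximum principle ([exp_mod_lin]).

    The function theory rests on the maximum principle, which comes from the
    mean value property, which in turn is Goursat's lemma for [u |-> f (w + e^u)]
    on a rectangle of height [2 pi] ([goursat], [mean_value_property],
    [maximum_principle]). Applied to difference quotients, the maximum principle
    shows that [(f z - f a) / (z - a)] is differentiable at [a] too
    ([holo_division]). Iterated division by [z] gives the Taylor expansion, whose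
    coefficients are bounded by a mean square argument, hence the density of the
    polynomials ([polynomial_density]). *)

(** * The modulus *)

Definition cmod (R : realType) (z : R[i]) : R := Normc.normc z.
Arguments cmod : simpl never.

Section modulus.
Variable R : realType.
Local Notation C := R[i].
Implicit Types (x y z w : C) (a b e t : R).

Lemma cmodE z : `|z| = (cmod z)%:C.
Proof. by rewrite normc_def; case: z. Qed.

Lemma Re_normE z : complex.Re `|z| = cmod z.
Proof. by rewrite cmodE. Qed.

Lemma cmod_le z a : (cmod z <= a) = (`|z| <= a%:C).
Proof. by rewrite cmodE lecR. Qed.

Lemma cmod_lt z a : (cmod z < a) = (`|z| < a%:C).
Proof. by rewrite cmodE ltcR. Qed.

Lemma cmod_ge0 z : 0 <= cmod z.
Proof. by case: z => a b; exact: sqrtr_ge0. Qed.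

Lemma cmod0 : cmod (0 : C) = 0. Proof. exact: Normc.normc0. Qed.
Lemma cmod1 : cmod (1 : C) = 1. Proof. exact: Normc.normc1. Qed.

Lemma cmodM x y : cmod (x * y) = cmod x * cmod y.
Proof. exact: Normc.normcM. Qed.

Lemma cmodV x : cmod x^-1 = (cmod x)^-1.
Proof. exact: Normc.normcV. Qed.

Lemma cmodX x n : cmod (x ^+ n) = cmod x ^+ n.
Proof. by elim: n => [|n IH]; rewrite ?expr0 ?cmod1// !exprS cmodM IH. Qed.

Lemma cmodN x : cmod (- x) = cmod x.
Proof. by apply: complexI; rewrite -!cmodE normrN. Qed.

Lemma cmodB x y : cmod (x - y) = cmod (y - x).
Proof. by rewrite -cmodN opprB. Qed.

Lemma cmodD x y : cmod (x + y) <= cmod x + cmod y.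
Proof. by rewrite -lecR rmorphD/= -!cmodE ler_normD. Qed.

Lemma cmodD_le x y : cmod (x - y) <= cmod x + cmod y.
Proof. by rewrite -(cmodN y) cmodD. Qed.

Lemma cmod_triangle x y z : cmod (x - z) <= cmod (x - y) + cmod (y - z).
Proof. by apply: le_trans (cmodD _ _); rewrite addrA subrK. Qed.

Lemma cmodB_ge x y : cmod x - cmod y <= cmod (x - y).
Proof. by rewrite lerBlDr; apply: le_trans (cmodD _ _); rewrite subrK. Qed.

Lemma cmod_sum (I : Type) (r : seq I) (P : pred I) (F : I -> C) :
  cmod (\sum_(i <- r | P i) F i) <= \sum_(i <- r | P i) cmod (F i).
Proof.
elim/big_ind2 : _ => //; first by rewrite cmod0.
by move=> x a y b xa yb; apply: le_trans (cmodD _ _) _; exact: lerD.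
Qed.

Lemma cmod_eq0 z : (cmod z == 0) = (z == 0).
Proof.
by apply/eqP/eqP => [/Normc.eq0_normc//|->]; rewrite cmod0.
Qed.

Lemma cmod_gt0 z : (0 < cmod z) = (z != 0).
Proof. by rewrite lt_neqAle eq_sym cmod_eq0 cmod_ge0 andbT. Qed.

Lemma cmod_real a : cmod a%:C = `|a|.
Proof. by rewrite /cmod /= expr0n/= addr0 sqrtr_sqr. Qed.

Lemma cmod_sqr z : cmod z ^+ 2 = complex.Re z ^+ 2 + complex.Im z ^+ 2.
Proof. by case: z => a b; rewrite /cmod /= sqr_sqrtr// addr_ge0 ?sqr_ge0. Qed.

Lemma cmodJ z : cmod z^*%C = cmod z.
Proof. by case: z => a b; rewrite /cmod /= sqrrN. Qed.

Lemma norm_Re_cmod z : `|complex.Re z| <= cmod z.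
Proof. by rewrite -lecR -cmodE normc_ge_Re. Qed.

Lemma Re_cmod z : complex.Re z <= cmod z.
Proof. exact: le_trans (ler_norm _) (norm_Re_cmod z). Qed.

Lemma norm_Im_cmod z : `|complex.Im z| <= cmod z.
Proof.
rewrite -(ler_pXn2r (_ : (0 < 2)%N))// ?nnegrE ?cmod_ge0//.
by rewrite cmod_sqr real_normK ?num_real// lerDr sqr_ge0.
Qed.

Lemma cmod_ReIm z : cmod z <= `|complex.Re z| + `|complex.Im z|.
Proof.
case: z => a b /=; rewrite [a +i* b]complexE/=.
apply: le_trans (cmodD _ _) _; rewrite cmodM !cmod_real.
by rewrite /cmod /= expr0n/= expr1n add0r sqrtr1 mul1r.
Qed.

Lemma ReD x y : complex.Re (x + y) = complex.Re x + complex.Re y.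
Proof. by case: x y => a b [c d]. Qed.
Lemma ReN x : complex.Re (- x) = - complex.Re x.
Proof. by case: x. Qed.
Lemma ReB x y : complex.Re (x - y) = complex.Re x - complex.Re y.
Proof. by rewrite ReD ReN. Qed.
Lemma ImD x y : complex.Im (x + y) = complex.Im x + complex.Im y.
Proof. by case: x y => a b [c d]. Qed.
Lemma ImN x : complex.Im (- x) = - complex.Im x.
Proof. by case: x. Qed.
Lemma ImB x y : complex.Im (x - y) = complex.Im x - complex.Im y.
Proof. by rewrite ImD ImN. Qed.
Lemma ReM x y : complex.Re (x * y) =
  complex.Re x * complex.Re y - complex.Im x * complex.Im y.
Proof. by case: x y => a b [c d]. Qed.
Lemma ImM x y : complex.Im (x * y) =
  complex.Re x * complex.Im y + complex.Im x * complex.Re y.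
Proof. by case: x y => a b [c d]. Qed.

Lemma complex_eq x y : complex.Re x = complex.Re y ->
  complex.Im x = complex.Im y -> x = y.
Proof. by case: x y => a b [c d] /= -> ->. Qed.

Lemma near_cmod z (P : C -> Prop) :
  (\forall w \near z, P w) <->
  exists2 t, 0 < t & forall w, cmod (w - z) < t -> P w.
Proof.
split=> [/nbhs_normP[[t u]]/= | [t t0 zP]].
  rewrite ltcE/= => /andP[/eqP-> t0] zP; exists t => // w wz.
  by apply: zP; rewrite /ball_/= distrC -[ltRHS]/(t%:C) -cmod_lt.
have : 0 < t%:C by rewrite ltcR.
move=> /(near_dist z); apply: filterS => w.
by rewrite distrC -cmod_lt; exact: zP.
Qed.

End modulus.

(** * Continuity and complex differentiability with real gauges *)

Definition ccont (R : realType) (K : R[i] -> Prop) (f : R[i] -> R[i]) z :=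
  forall e : R, 0 < e -> exists2 t : R, 0 < t &
    forall w, K w -> cmod (w - z) < t -> cmod (f w - f z) < e.

(** The error of the affine approximation is compared with [cmod (w - z)], a real
    number: estimates in [R[i]] itself would suffer from its partial order. *)
Definition cdiff (R : realType) (f : R[i] -> R[i]) z d :=
  forall e : R, 0 < e -> exists2 t : R, 0 < t &
    forall w, cmod (w - z) < t ->
      cmod (f w - f z - d * (w - z)) <= e * cmod (w - z).

Definition cderivable (R : realType) (f : R[i] -> R[i]) z :=
  exists d, cdiff f z d.

Notation whole := (fun=> True).
Definition disc (R : realType) : set R[i] := [set z | cmod z <= 1].

Section differentiability.
Variable R : realType.
Local Notation C := R[i].
Implicit Types (f g : C -> C) (z w d : C) (e t : R).

Let slopeE (d h x : C) : h != 0 -> d - h^-1 * x = - h^-1 * (x - d * h).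
Proof. by move=> h0; field. Qed.

Lemma cderivableP f z : cderivable f z <-> derivable f z 1.
Proof.
split=> [[d fd]|/cvg_ex[d fd]].
  apply/cvg_ex; exists d; apply/cvgrPdist_le => -[e e'].
  rewrite ltcE/= => /andP[/eqP-> e0].
  apply/near_cmod; have [t t0 ft] := fd _ e0; exists t => // h.
  rewrite subr0 => ht /= h0; rewrite -[leRHS]/(e%:C) -cmod_le.
  rewrite [(_ : C) *: 1]mulr1.
  rewrite [X in cmod X](slopeE d (f (h + z) - f z) h0).
  rewrite cmodM cmodN cmodV mulrC ler_pdivrMr ?cmod_gt0//.
  by have := ft (h + z); rewrite addrK; apply.
exists d => e e0; move/cvgrPdist_le : fd => /(_ e%:C).
rewrite ltcR => /(_ e0) /near_cmod[t t0 ft]; exists t => // w wt.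
have [->|wz] := eqVneq w z; first by rewrite !subrr mulr0 subr0 cmod0 mulr0.
have wz0 : w - z != 0 by rewrite subr_eq0.
have := ft (w - z); rewrite subr0 => /(_ wt wz0)/=.
rewrite [(_ : C) *: 1]mulr1 subrK -cmod_le.
rewrite [X in cmod X](slopeE d (f w - f z) wz0).
by rewrite cmodM cmodN cmodV mulrC ler_pdivrMr ?cmod_gt0.
Qed.

Lemma eq_cdiff f g z d : f =1 g -> cdiff f z d -> cdiff g z d.
Proof. by move=> /funext <-. Qed.

Lemma near_cdiff f g z d r : 0 < r ->
  (forall w, cmod (w - z) < r -> f w = g w) -> cdiff f z d -> cdiff g z d.
Proof.
move=> r0 fg fd e e0; have [t t0 ft] := fd e e0.
exists (Order.min t r); first by rewrite lt_min t0.
move=> w; rewrite lt_min => /andP[wt wr].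
by rewrite -(fg w wr) -(fg z) ?subrr ?cmod0//; exact: ft.
Qed.

Lemma near_cderivable f g z r : 0 < r ->
  (forall w, cmod (w - z) < r -> f w = g w) -> cderivable f z -> cderivable g z.
Proof. by move=> r0 fg [d fd]; exists d; apply: near_cdiff fd; eassumption. Qed.

Lemma cderivable_cst (c : C) z : cderivable (cst c) z.
Proof. by apply/cderivableP; exact: derivable_cst. Qed.

Lemma cdiff_affine (a b : C) z : cdiff (fun w => a * w + b) z a.
Proof.
move=> e e0; exists 1 => // w _ /=.
rewrite [X in cmod X](_ : _ = 0); last by ring.
by rewrite cmod0 mulr_ge0 ?cmod_ge0// ltW.
Qed.

Lemma cderivable_id z : cderivable id z.
Proof.
exists 1; apply: eq_cdiff (cdiff_affine 1 0 z) => w.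
by rewrite mul1r addr0.
Qed.

Lemma cderivableD f g z : cderivable f z -> cderivable g z ->
  cderivable (fun w => f w + g w) z.
Proof.
by move=> /cderivableP df /cderivableP dg; apply/cderivableP; exact: (derivableD df dg).
Qed.

Lemma cderivableB f g z : cderivable f z -> cderivable g z ->
  cderivable (fun w => f w - g w) z.
Proof.
by move=> /cderivableP df /cderivableP dg; apply/cderivableP; exact: (derivableB df dg).
Qed.

Lemma cderivableM f g z : cderivable f z -> cderivable g z ->
  cderivable (fun w => f w * g w) z.
Proof.
by move=> /cderivableP df /cderivableP dg; apply/cderivableP; exact: (derivableM df dg).
Qed.

Lemma cderivableV f z : f z != 0 -> cderivable f z ->
  cderivable (fun w => (f w)^-1) z.
Proof.
by move=> fz /cderivableP df; apply/cderivableP; exact: (derivableV fz df).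
Qed.

Lemma cdiff_cont f z d : cdiff f z d -> ccont whole f z.
Proof.
move=> fd e e0; have [t t0 ft] := fd 1 ltr01.
pose r := e / (cmod d + 2).
have d0 := cmod_ge0 d.
have dp : 0 < cmod d + 2 by lra.
have r0 : 0 < r by rewrite divr_gt0.
exists (Order.min t r); first by rewrite lt_min t0.
move=> w _; rewrite lt_min => /andP[wt wr].
rewrite -(subrK (d * (w - z)) (f w - f z)).
apply: le_lt_trans (cmodD _ _) _; rewrite cmodM.
apply: le_lt_trans (_ : (cmod d + 1) * cmod (w - z) < _).
  by rewrite addrC mulrDl lerD2l ft.
have w0 := cmod_ge0 (w - z).
apply: le_lt_trans (_ : (cmod d + 1) * r < _).
  by rewrite ler_wpM2l// ?ltW//; lra.
by rewrite /r mulrC mulrAC ltr_pdivrMr// ltr_pM2l//; lra.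
Qed.

Lemma cderivable_cont f z : cderivable f z -> ccont whole f z.
Proof. by case=> d /cdiff_cont. Qed.

Lemma cdiff_comp f g z d d' : cdiff f z d -> cdiff g (f z) d' ->
  cdiff (g \o f) z (d' * d).
Proof.
move=> fd gd e e0; have d0 := cmod_ge0 d; have d'0 := cmod_ge0 d'.
pose e1 := e / 2 / (cmod d + 1); pose e2 := Order.min 1 (e / 2 / (cmod d' + 1)).
have e10 : 0 < e1 by rewrite /e1 !divr_gt0//; lra.
have e20 : 0 < e2 by rewrite lt_min ltr01/= !divr_gt0//; lra.
have [t t0 ft] := fd _ e20; have [s s0 gs] := gd _ e10.
have [r r0 fr] := cdiff_cont fd s0.
exists (Order.min t r); first by rewrite lt_min t0.
move=> w; rewrite lt_min => /andP[wt wr].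
have {}ft := ft _ wt; have {}fr := fr _ I wr; have {}gs := gs _ fr.
have w0 := cmod_ge0 (w - z); set D := cmod (w - z) in ft w0 *.
have fle : cmod (f w - f z) <= (cmod d + 1) * D.
  rewrite -(subrK (d * (w - z)) (f w - f z)).
  apply: le_trans (cmodD _ _) _; rewrite cmodM addrC mulrDl lerD2l mul1r.
  apply: le_trans ft _; rewrite -[leRHS]mul1r ler_wpM2r//.
  by rewrite ge_min lexx.
rewrite /= [X in cmod X](_ : _ = (g (f w) - g (f z) - d' * (f w - f z)) +
  d' * (f w - f z - d * (w - z))); last by ring.
apply: le_trans (cmodD _ _) _; rewrite cmodM [e]splitr mulrDl lerD//.
  apply: le_trans gs _; apply: le_trans (ler_wpM2l (ltW e10) fle) _.
  by rewrite mulrA ler_wpM2r// /e1 divfK//; lra.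
apply: le_trans (ler_wpM2l d'0 ft) _; rewrite mulrA ler_wpM2r//.
apply: le_trans (_ : cmod d' * (e / 2 / (cmod d' + 1)) <= _).
  by rewrite ler_wpM2l// ge_min lexx orbT.
rewrite mulrCA -[leRHS]mulr1 ler_wpM2l//; first by lra.
by rewrite ler_pdivrMr//; lra.
Qed.

Lemma cderivable_comp f g z : cderivable f z -> cderivable g (f z) ->
  cderivable (fun w => g (f w)) z.
Proof.
by move=> [d fd] [d' gd]; exists (d' * d); exact: cdiff_comp gd.
Qed.

Lemma ccontW (K : C -> Prop) f z : ccont whole f z -> ccont K f z.
Proof.
by move=> fc e /fc[t t0 ft]; exists t => // w _; exact: ft.
Qed.

Lemma ccont_comp (K : C -> Prop) f g z : ccont K f z -> ccont whole g (f z) ->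
  ccont K (fun w => g (f w)) z.
Proof.
move=> fc gc e /gc[t t0 gt]; have [s s0 fs] := fc t t0.
by exists s => // w Kw ws; apply: gt => //; exact: fs.
Qed.

Lemma ccontD (K : C -> Prop) f g z : ccont K f z -> ccont K g z ->
  ccont K (fun w => f w + g w) z.
Proof.
move=> fc gc e e0; have e20 : 0 < e / 2 by rewrite divr_gt0.
have [t t0 ft] := fc _ e20; have [s s0 gs] := gc _ e20.
exists (Order.min t s); first by rewrite lt_min t0.
move=> w Kw; rewrite lt_min => /andP[wt ws].
rewrite opprD addrACA; apply: le_lt_trans (cmodD _ _) _.
by rewrite [e]splitr ltrD// ?ft ?gs.
Qed.

Lemma ccontM (K : C -> Prop) f g z : ccont K f z -> ccont K g z ->
  ccont K (fun w => f w * g w) z.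
Proof.
move=> fc gc e e0.
have f0 := cmod_ge0 (f z); have g0 := cmod_ge0 (g z).
pose e1 := e / 2 / (cmod (g z) + 1).
pose e2 := e / 2 / (cmod (f z) + e1 + 1).
have e10 : 0 < e1 by rewrite !divr_gt0//; lra.
have e20 : 0 < e2 by rewrite !divr_gt0//; lra.
have [t t0 ft] := fc _ e10; have [s s0 gs] := gc _ e20.
exists (Order.min t s); first by rewrite lt_min t0.
move=> w Kw; rewrite lt_min => /andP[wt ws].
have {}ft := ft _ Kw wt; have {}gs := gs _ Kw ws.
have fw : cmod (f w) <= cmod (f z) + e1.
  by rewrite -(subrK (f z) (f w)) addrC; apply: le_trans (cmodD _ _) _; lra.
rewrite /= [X in cmod X](_ : _ = f w * (g w - g z) + (f w - f z) * g z); last by ring.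
apply: le_lt_trans (cmodD _ _) _; rewrite !cmodM [e]splitr.
have fw0 := cmod_ge0 (f w).
apply: ler_ltD.
  apply: le_trans (ler_pM fw0 (cmod_ge0 _) fw (ltW gs)) _.
  by rewrite /e2 mulrCA -[leRHS]mulr1 ler_wpM2l ?ler_pdivrMr; lra.
apply: le_lt_trans (ler_wpM2r g0 (ltW ft)) _.
rewrite /e1 mulrAC ltr_pdivrMr; last by lra.
by rewrite ltr_pM2l ?divr_gt0//; lra.
Qed.

Lemma ccont_cst (K : C -> Prop) c z : ccont K (cst c) z.
Proof. by move=> e e0; exists 1 => // w _ _; rewrite subrr cmod0. Qed.

Lemma ccontB (K : C -> Prop) f g z : ccont K f z -> ccont K g z ->
  ccont K (fun w => f w - g w) z.
Proof.
move=> fc gc; have -> : (fun w => f w - g w) = (fun w => f w + (cst (-1) w) * g w).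
  by apply/funext => w; rewrite mulN1r.
by apply: ccontD => //; apply: ccontM => //; exact: ccont_cst.
Qed.

Lemma eq_ccont (K : C -> Prop) f g z : (forall w, K w -> f w = g w) -> K z ->
  ccont K f z -> ccont K g z.
Proof.
move=> fg Kz fc e /fc[t t0 ft]; exists t => // w Kw wt.
by rewrite -!fg//; exact: ft.
Qed.

Lemma ccont_within (K : set C) f :
  (forall z, K z -> ccont K f z) <-> {within K, continuous f}.
Proof.
rewrite subspace_continuousP; split=> fc z Kz.
  apply/cvgrPdist_lt => -[e e'] /[!ltcE]/= /andP[/eqP-> e0].
  have [t t0 ft] := fc z Kz e e0; apply/near_cmod; exists t => // w wz Kw.
  by rewrite distrC -[ltRHS]/(e%:C) -cmod_lt ft.
move=> e e0; have /cvgrPdist_lt/(_ e%:C) := fc z Kz.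
rewrite ltcR => /(_ e0) /near_cmod[t t0 ft]; exists t => // w Kw wt.
by rewrite cmod_lt distrC; exact: ft.
Qed.

End differentiability.

(** * Real calculus *)

Section real_calculus.
Variable R : realType.
Implicit Types (f : R -> R) (a b x M : R).

Lemma mean_value_le f f' a b M : a <= b ->
  (forall x, a <= x <= b -> is_derive x 1 f (f' x)) ->
  (forall x, a <= x <= b -> `|f' x| <= M) -> `|f b - f a| <= M * (b - a).
Proof.
rewrite le_eqVlt => /predU1P[->|ab] fd fM; first by rewrite !subrr normr0 mulr0.
have fc : {within `[a, b], continuous f}.
  apply: derivable_within_continuous => x; rewrite in_itv/= => xab.
  by case: (fd _ xab).
have fdo x : x \in `]a, b[ -> is_derive x 1 f (f' x).
  by rewrite in_itv/= => /andP[ax xb]; apply: fd; rewrite !ltW.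
have [c] := MVT ab fdo fc; rewrite in_itv/= => /andP[ac cb] ->.
have ba : 0 <= b - a by lra.
by rewrite normrM (ger0_norm ba) ler_wpM2r// fM// !ltW.
Qed.

Lemma antiderivative f a b : continuous f ->
  exists F, forall x, a < x < b -> is_derive x 1 F (f x).
Proof.
move=> fc; exists (fun x => \int[lebesgue_measure]_(t in `[a, x]) f t)%R.
move=> x /andP[ax xb].
have fi : (@lebesgue_measure R).-integrable `[a, b] (EFin \o f).
  apply: continuous_compact_integrable; first exact: segment_compact.
  exact: continuous_subspaceT.
have [dF F'] := continuous_FTC1_closed xb fi ax (fc x).
by split; [exact: dF|rewrite -derive1E; exact: F'].
Qed.

Lemma ge0_derive_le (f f' : R -> R) (a b : R) : a <= b ->
  (forall x, a <= x <= b -> is_derive x 1 f (f' x)) ->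
  (forall x, a <= x <= b -> 0 <= f' x) -> f a <= f b.
Proof.
rewrite le_eqVlt => /predU1P[->//|ab] fd f0.
have fc : {within `[a, b], continuous f}.
  apply: derivable_within_continuous => x; rewrite in_itv/= => xab.
  by case: (fd _ xab).
have fdo x : x \in `]a, b[ -> is_derive x 1 f (f' x).
  by rewrite in_itv/= => /andP[ax xb]; apply: fd; rewrite !ltW.
have [c] := MVT ab fdo fc; rewrite in_itv/= => /andP[ac cb] fE.
by rewrite -subr_ge0 fE mulr_ge0 ?subr_ge0 ?f0 ?ltW// ltW.
Qed.

Lemma eq_derive_diff (f g f' : R -> R) (a b : R) : a <= b ->
  (forall x, a <= x <= b -> is_derive x 1 f (f' x)) ->
  (forall x, a <= x <= b -> is_derive x 1 g (f' x)) -> f b - f a = g b - g a.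
Proof.
move=> ab fd gd; have fgd x : a <= x <= b -> is_derive x 1 (f - g) (f' x - f' x).
  by move=> xab; exact: (is_deriveB (fd x xab) (gd x xab)).
have f0 x : a <= x <= b -> `|f' x - f' x| <= 0 by rewrite subrr normr0.
have := mean_value_le ab fgd f0; rewrite mul0r normr_le0 subr_eq0 => /eqP.
by rewrite -[(f - g) b]/(f b - g b) -[(f - g) a]/(f a - g a); lra.
Qed.

Lemma is_derive_linear (k t : R) : is_derive t 1 (fun v : R => k * v) k.
Proof.
by have := is_deriveZ k (is_derive_id t 1); rewrite [k *: 1]mulr1; apply.
Qed.

End real_calculus.

(** * Goursat's lemma *)

Section bisection.
Variable R : realType.
Variables (H : R -> R -> R) (x0 y0 w h : R).
Hypotheses (w0 : 0 <= w) (h0 : 0 <= h).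

Let D (x y s t : R) := H (x + s) (y + t) - H (x + s) y - H x (y + t) + H x y.
Let ww n := w / 2 ^+ n.
Let hh n := h / 2 ^+ n.

Let halve (c : R) n : c / 2 ^+ n = c / 2 ^+ n.+1 + c / 2 ^+ n.+1.
Proof. by rewrite exprS invfM [2^-1 * _]mulrC mulrA -splitr. Qed.

Let DnE x y n : D x y (ww n) (hh n) =
  (D x y (ww n.+1) (hh n.+1) + D (x + ww n.+1) y (ww n.+1) (hh n.+1)) +
  (D x (y + hh n.+1) (ww n.+1) (hh n.+1) +
   D (x + ww n.+1) (y + hh n.+1) (ww n.+1) (hh n.+1)).
Proof.
rewrite /D /ww /hh (halve w n) (halve h n) !addrA; ring.
Qed.

Let big e n (p : R * R) := e / 4 ^+ n < `|D p.1 p.2 (ww n) (hh n)|.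

Let child n (p : R * R) (b c : bool) : R * R :=
  (if b then p.1 + ww n.+1 else p.1, if c then p.2 + hh n.+1 else p.2).

Let next e n (p : R * R) :=
  if `[< big e n.+1 (child n p false false) >] then child n p false false else
  if `[< big e n.+1 (child n p true false) >] then child n p true false else
  if `[< big e n.+1 (child n p false true) >] then child n p false true else
  child n p true true.

Let next_big e n p : big e n p -> big e n.+1 (next e n p).
Proof.
rewrite /next; case: asboolP => // n1; case: asboolP => // n2.
case: asboolP => // n3; move: n1 n2 n3; rewrite /big /= => /negP + /negP + /negP.
rewrite -!leNgt => n1 n2 n3 bp; rewrite ltNge; apply/negP => n4.
move: bp; rewrite ltNge => /negP; apply; rewrite DnE.
have -> : e / 4 ^+ n = (e / 4 ^+ n.+1 + e / 4 ^+ n.+1) +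
    (e / 4 ^+ n.+1 + e / 4 ^+ n.+1).
  by rewrite exprS; field; rewrite expf_neq0.
apply: le_trans (ler_normD _ _) (lerD _ _);
  apply: le_trans (ler_normD _ _) (lerD _ _) => //.
Qed.

Let nextP e n p : exists b c, next e n p = child n p b c.
Proof.
rewrite /next; case: ifP => _; first by exists false, false.
case: ifP => _; first by exists true, false.
case: ifP => _; first by exists false, true.
by exists true, true.
Qed.

Let seqp e := fix seqp n := if n is n'.+1 then next e n' (seqp n') else (x0, y0).

Let ww_ge0 n : 0 <= ww n. Proof. by rewrite divr_ge0// exprn_ge0. Qed.
Let hh_ge0 n : 0 <= hh n. Proof. by rewrite divr_ge0// exprn_ge0. Qed.

Let seqpS e n : let p := seqp e n in let q := seqp e n.+1 in
  [/\ p.1 <= q.1, q.1 + ww n.+1 <= p.1 + ww n, p.2 <= q.2 &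
      q.2 + hh n.+1 <= p.2 + hh n].
Proof.
move=> p q; have [b [c qE]] := nextP e n p.
have {}qE : q = child n p b c by [].
have w1 := ww_ge0 n.+1; have h1 := hh_ge0 n.+1.
have wE : ww n = ww n.+1 + ww n.+1 := halve w n.
have hE : hh n = hh n.+1 + hh n.+1 := halve h n.
by rewrite qE wE hE; case: b {qE}; case: c => /=; split; lra.
Qed.

Let seqp_mono e n m : (n <= m)%N -> let p := seqp e n in let q := seqp e m in
  [/\ p.1 <= q.1, q.1 + ww m <= p.1 + ww n, p.2 <= q.2 &
      q.2 + hh m <= p.2 + hh n].
Proof.
elim: m => [|m IH]; first by rewrite leqn0 => /eqP->.
rewrite leq_eqVlt => /predU1P[->//|]; rewrite ltnS => /IH/=[a b c d].
have /=[a' b' c' d'] := seqpS e m.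
split; [exact: le_trans a a'|exact: le_trans b' b|exact: le_trans c c'|
  exact: le_trans d' d].
Qed.

(** Any two of the nested rectangles meet, so the supremum of their lower left
    corners lies in all of them. *)
Let nested_point e : exists p : R * R, forall n, let q := seqp e n in
  (q.1 <= p.1 <= q.1 + ww n) && (q.2 <= p.2 <= q.2 + hh n).
Proof.
have below n m : (seqp e m).1 <= (seqp e n).1 + ww n /\
    (seqp e m).2 <= (seqp e n).2 + hh n.
  have [nm|/ltnW mn] := leqP n m.
    have /=[_ a _ b] := seqp_mono e nm.
    by have := ww_ge0 m; have := hh_ge0 m; split; lra.
  have /=[a _ b _] := seqp_mono e mn.
  by have := ww_ge0 n; have := hh_ge0 n; split; lra.
exists (sup (range (fun n => (seqp e n).1)), sup (range (fun n => (seqp e n).2))).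
move=> n /=; apply/andP; split; apply/andP; split.
- apply: ub_le_sup; last by exists n.
  by exists ((seqp e n).1 + ww n) => _ [m _ <-]; exact: (below n m).1.
- by apply: ge_sup; [exists x0, 0%N|move=> _ [m _ <-]; exact: (below n m).1].
- apply: ub_le_sup; last by exists n.
  by exists ((seqp e n).2 + hh n) => _ [m _ <-]; exact: (below n m).2.
- by apply: ge_sup; [exists y0, 0%N|move=> _ [m _ <-]; exact: (below n m).2].
Qed.

(** Second differences of [H] add up when a rectangle is cut into quarters, so a
    nonzero value survives, divided by 4 at each step, in a nested sequence of
    rectangles; the hypothesis excludes this at their common point. *)
Lemma second_difference0 :
  (forall px py e, 0 < e -> x0 <= px <= x0 + w -> y0 <= py <= y0 + h ->
    exists N, forall n x y, (N <= n)%N ->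
      x0 <= x -> x + w / 2 ^+ n <= x0 + w -> y0 <= y -> y + h / 2 ^+ n <= y0 + h ->
      x <= px <= x + w / 2 ^+ n -> y <= py <= y + h / 2 ^+ n ->
      `|D x y (w / 2 ^+ n) (h / 2 ^+ n)| <= e / 4 ^+ n) ->
  H (x0 + w) (y0 + h) - H (x0 + w) y0 - H x0 (y0 + h) + H x0 y0 = 0.
Proof.
move=> small; apply/eqP; rewrite -normr_le0 leNgt; apply/negP => D0.
pose e := `|D x0 y0 w h| / 2.
have e0 : 0 < e by rewrite divr_gt0.
have bigS n : big e n (seqp e n).
  elim: n => [|n]; last exact: next_big.
  by rewrite /big /= /ww /hh expr0 !divr1 /e ltr_pdivrMr// ltr_pMr// ltr1n.
have [[px py] pP] := nested_point e.
have := pP 0%N; rewrite /= /ww /hh expr0 !divr1 => /andP[Px Py].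
have [N] := small px py e e0 Px Py.
have /=[a b c d] := seqp_mono e (leq0n N).
move: b d; rewrite {2}/ww {2}/hh expr0 !divr1 => b d.
have /andP[px1 py1] := pP N.
move=> /(_ N (seqp e N).1 (seqp e N).2 (leqnn N) a b c d px1 py1).
by rewrite leNgt; have := bigS N; rewrite /big => ->.
Qed.

End bisection.

Section goursat.
Variable R : realType.
Local Notation C := R[i].
Variables (g : C -> C) (AP AQ : R -> R -> R) (x0 x1 y0 y1 : R).
Hypotheses (x01 : x0 <= x1) (y01 : y0 <= y1).
Let rect (z : C) := (x0 <= complex.Re z <= x1) && (y0 <= complex.Im z <= y1).

Hypothesis gd : forall z, rect z -> exists d, forall e, 0 < e ->
  exists2 t, 0 < t & forall u, rect u -> cmod (u - z) < t ->
    cmod (g u - g z - d * (u - z)) <= e * cmod (u - z).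
Hypothesis AP' : forall x y, x0 <= x <= x1 -> y0 <= y <= y1 ->
  is_derive x 1 (AP^~ y) (complex.Im (g (x +i* y))).
Hypothesis AQ' : forall x y, x0 <= x <= x1 -> y0 <= y <= y1 ->
  is_derive y 1 (AQ x) (complex.Re (g (x +i* y))).

Let H x y := AQ x y - AP x y.

(** Up to [o((s + u)^2)], the second differences of [AQ] and [AP] over a rectangle
    of sides [s] and [u] are both [s * u] times the real part of the derivative
    of [g]: this is where the Cauchy-Riemann equations enter. *)
Let rect_estimate z d e t x y s u : 0 <= s -> 0 <= u -> rect z ->
  0 <= e ->
  (forall v, rect v -> cmod (v - z) < t ->
    cmod (g v - g z - d * (v - z)) <= e * cmod (v - z)) ->
  x0 <= x -> x + s <= x1 -> y0 <= y -> y + u <= y1 ->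
  x <= complex.Re z <= x + s -> y <= complex.Im z <= y + u -> s + u < t ->
  `|H (x + s) (y + u) - H (x + s) y - H x (y + u) + H x y|
    <= 2 * e * (s + u) ^+ 2.
Proof.
case: z d => px py [dr di] /= s0 u0 zr e0 gz xx xs yy yu /andP[px1 px2]
  /andP[py1 py2] sut.
have err a b : x <= a <= x + s -> y <= b <= y + u ->
    cmod (g (a +i* b) - g (px +i* py) - (dr +i* di) * ((a +i* b) - (px +i* py)))
    <= e * (s + u).
  move=> /andP[a1 a2] /andP[b1 b2].
  have dist : cmod ((a +i* b) - (px +i* py)) <= s + u.
    apply: le_trans (cmod_ReIm _) _; rewrite ReB ImB /= lerD//.
      by rewrite ler_norml; apply/andP; split; lra.
    by rewrite ler_norml; apply/andP; split; lra.
  apply: le_trans (gz _ _ _) _; last by rewrite ler_wpM2l.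
    by rewrite /rect/=; apply/andP; split; apply/andP; split; lra.
  exact: le_lt_trans dist sut.
have Qd b : y <= b <= y + u -> `|complex.Re (g ((x + s) +i* b)) -
    complex.Re (g (x +i* b)) - dr * s| <= 2 * e * (s + u).
  move=> bb; have xl : x <= x <= x + s by rewrite lexx/=; lra.
  have xr : x <= x + s <= x + s by rewrite lexx andbT; lra.
  have := lerD (err _ _ xr bb) (err _ _ xl bb).
  move/(le_trans (cmodD_le _ _)) => /(le_trans (norm_Re_cmod _)).
  rewrite !(ReB, ReM) !ImB /= (_ : e * (s + u) + _ = 2 * e * (s + u)); last by ring.
  by apply: le_trans; rewrite le_eqVlt; apply/orP; left; apply/eqP; congr `|_|; ring.
have Pd a : x <= a <= x + s -> `|complex.Im (g (a +i* (y + u))) -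
    complex.Im (g (a +i* y)) - dr * u| <= 2 * e * (s + u).
  move=> aa; have yl : y <= y <= y + u by rewrite lexx/=; lra.
  have yr : y <= y + u <= y + u by rewrite lexx andbT; lra.
  have := lerD (err _ _ aa yr) (err _ _ aa yl).
  move/(le_trans (cmodD_le _ _)) => /(le_trans (norm_Im_cmod _)).
  rewrite !(ImB, ImM) !ReB /= (_ : e * (s + u) + _ = 2 * e * (s + u)); last by ring.
  by apply: le_trans; rewrite le_eqVlt; apply/orP; left; apply/eqP; congr `|_|; ring.
have EQ : `|(AQ (x + s) (y + u) - AQ x (y + u) - dr * s * (y + u)) -
    (AQ (x + s) y - AQ x y - dr * s * y)| <= 2 * e * (s + u) * (y + u - y).
  apply: (@mean_value_le _ (fun v => AQ (x + s) v - AQ x v - dr * s * v)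
    (fun v => complex.Re (g ((x + s) +i* v)) - complex.Re (g (x +i* v)) - dr * s)).
  - by lra.
  - move=> v /andP[v1 v2]; have v01 : y0 <= v <= y1 by apply/andP; split; lra.
    have xs1 : x0 <= x + s <= x1 by apply/andP; split; lra.
    have xx1 : x0 <= x <= x1 by apply/andP; split; lra.
    exact: (is_deriveB (is_deriveB (AQ' xs1 v01) (AQ' xx1 v01)) (is_derive_linear (dr * s) v)).
  - by move=> v; exact: Qd.
have EP : `|(AP (x + s) (y + u) - AP (x + s) y - dr * u * (x + s)) -
    (AP x (y + u) - AP x y - dr * u * x)| <= 2 * e * (s + u) * (x + s - x).
  apply: (@mean_value_le _ (fun v => AP v (y + u) - AP v y - dr * u * v)
    (fun v => complex.Im (g (v +i* (y + u))) - complex.Im (g (v +i* y)) - dr * u)).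
  - by lra.
  - move=> v /andP[v1 v2]; have v01 : x0 <= v <= x1 by apply/andP; split; lra.
    have yu1 : y0 <= y + u <= y1 by apply/andP; split; lra.
    have yy1 : y0 <= y <= y1 by apply/andP; split; lra.
    exact: (is_deriveB (is_deriveB (AP' v01 yu1) (AP' v01 yy1)) (is_derive_linear (dr * u) v)).
  - by move=> v; exact: Pd.
have := le_trans (ler_normB _ _) (lerD EQ EP).
have -> : 2 * e * (s + u) * (y + u - y) + 2 * e * (s + u) * (x + s - x) =
  2 * e * (s + u) ^+ 2 by ring.
by apply: le_trans; rewrite le_eqVlt; apply/orP; left; apply/eqP; congr `|_|;
  rewrite /H; ring.
Qed.

(** The second differences of [AQ] and [AP] are the integrals of the real and
    imaginary parts of [g] along the vertical and the horizontal sides of the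
    rectangle, so this is the vanishing of the imaginary part of the contour
    integral of [g]. *)
Lemma goursat : AQ x1 y1 - AQ x1 y0 - AQ x0 y1 + AQ x0 y0 =
  AP x1 y1 - AP x1 y0 - AP x0 y1 + AP x0 y0.
Proof.
apply/eqP; rewrite -subr_eq0; apply/eqP.
have w0 : 0 <= x1 - x0 by rewrite subr_ge0.
have h0 : 0 <= y1 - y0 by rewrite subr_ge0.
have xE : x0 + (x1 - x0) = x1 by ring.
have yE : y0 + (y1 - y0) = y1 by ring.
have := @second_difference0 _ H x0 y0 _ _ w0 h0; rewrite xE yE => SD.
rewrite -[RHS]SD; first by rewrite /H; ring.
move=> px py e e0 Px Py.
have zr : rect (px +i* py) by rewrite /rect/= Px.
have [d /= gz] := gd zr.
set w := x1 - x0; set h := y1 - y0.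
pose e1 := e / (2 * (w + h) ^+ 2 + 1).
have wh : 0 <= 2 * (w + h) ^+ 2 by rewrite mulr_ge0// sqr_ge0.
have e10 : 0 < e1 by rewrite divr_gt0// ltr_wpDl.
have [t t0 gt] := gz e1 e10.
have [N Nt] : exists N, (w + h) / 2 ^+ N < t.
  have := @cvg_geometric _ (w + h) (2^-1 : R).
  rewrite ger0_norm// invf_lt1// ltr1n => /(_ isT) /cvgrPdist_lt /(_ _ t0)[N _ /(_ N)].
  rewrite /= leqnn => /(_ isT); rewrite sub0r normrN => Nt; exists N.
  by apply: le_lt_trans Nt; rewrite /geometric /= exprVn ler_norm.
exists N => n x y Nn xx xs yy yu px1 py1.
have p2 : 0 < (2 : R) ^+ n by rewrite exprn_gt0.
have := @rect_estimate (px +i* py) d e1 t x y (w / 2 ^+ n) (h / 2 ^+ n).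
have sut : w / 2 ^+ n + h / 2 ^+ n < t.
  rewrite -mulrDl; apply: le_lt_trans Nt; apply: ler_wpM2l.
    exact: (addr_ge0 w0 h0).
  by rewrite lef_pV2 ?posrE ?exprn_gt0// ler_weXn2l// ler1n.
move=> /(_ _ _ zr (ltW e10) gt xx xs yy yu px1 py1 sut).
have -> : 0 <= w / 2 ^+ n by exact: divr_ge0 w0 (ltW p2).
have -> : 0 <= h / 2 ^+ n by exact: divr_ge0 h0 (ltW p2).
move=> /(_ isT isT) /le_trans; apply.
have -> : 2 * e1 * (w / 2 ^+ n + h / 2 ^+ n) ^+ 2 =
    2 * e1 * (w + h) ^+ 2 / 4 ^+ n.
  by rewrite (_ : 4 = 2 ^+ 2)// -?exprM 1?mulnC ?exprM; [field; rewrite lt0r_neq0|ring].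
apply: ler_wpM2r; first by rewrite invr_ge0 exprn_ge0.
have -> : 2 * e1 * (w + h) ^+ 2 = e * (2 * (w + h) ^+ 2) / (2 * (w + h) ^+ 2 + 1).
  by rewrite /e1; field; rewrite lt0r_neq0// ltr_wpDl.
rewrite ler_pdivrMr ?ltr_wpDl// ler_wpM2l//; first exact: ltW.
by rewrite lerDl.
Qed.

End goursat.

(** * The complex exponential and logarithm *)

Definition cexp (R : realType) (z : R[i]) : R[i] :=
  (expR (complex.Re z) * cos (complex.Im z)) +i*
  (expR (complex.Re z) * sin (complex.Im z)).

Definition clog (R : realType) (z : R[i]) : R[i] :=
  ln (cmod z) +i* atan (complex.Im z / complex.Re z).

Section curves.
Variable R : realType.
Local Notation C := R[i].
Implicit Types (F G : R -> C) (t : R) (d z : C).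

Definition curve_derive F t d :=
  is_derive t 1 (fun s => complex.Re (F s)) (complex.Re d) /\
  is_derive t 1 (fun s => complex.Im (F s)) (complex.Im d).

Lemma curve_deriveB F G t d d' : curve_derive F t d -> curve_derive G t d' ->
  curve_derive (fun s => F s - G s) t (d - d').
Proof.
move=> [F1 F2] [G1 G2]; split.
  rewrite (_ : (fun _ => _) = (fun s => complex.Re (F s)) - (fun s => complex.Re (G s))).
    by rewrite ReB; exact: is_deriveB.
  by apply/funext => s; rewrite ReB.
rewrite (_ : (fun _ => _) = (fun s => complex.Im (F s)) - (fun s => complex.Im (G s))).
  by rewrite ImB; exact: is_deriveB.
by apply/funext => s; rewrite ImB.
Qed.

Lemma curve_deriveD F G t d d' : curve_derive F t d -> curve_derive G t d' ->
  curve_derive (fun s => F s + G s) t (d + d').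
Proof.
move=> [F1 F2] [G1 G2]; split.
  rewrite (_ : (fun _ => _) = (fun s => complex.Re (F s)) + (fun s => complex.Re (G s))).
    by rewrite ReD; exact: is_deriveD.
  by apply/funext => s; rewrite ReD.
rewrite (_ : (fun _ => _) = (fun s => complex.Im (F s)) + (fun s => complex.Im (G s))).
  by rewrite ImD; exact: is_deriveD.
by apply/funext => s; rewrite ImD.
Qed.

Lemma curve_derive_real (f : R -> R) t (f' : R) z : is_derive t 1 f f' ->
  curve_derive (fun s => (f s)%:C * z) t (f'%:C * z).
Proof.
move=> fd; have fdZ c : is_derive t 1 (fun s => f s * c) (f' * c).
  rewrite (_ : (fun s => _) = (fun s => c *: f s)); last first.
    by apply/funext => s; exact: mulrC.
  by rewrite mulrC; exact: (is_deriveZ c fd).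
case: z => a b; split => /=.
  by rewrite mul0r subr0; under eq_fun do rewrite subr0; exact: fdZ.
by rewrite mul0r addr0; under eq_fun do rewrite addr0; exact: fdZ.
Qed.

Lemma is_derive_pow n t :
  is_derive t 1 (fun s : R => s ^+ n.+1) (n.+1%:R * t ^+ n).
Proof.
rewrite (_ : (fun s => _) = (@id R) ^+ n.+1); last first.
  by apply/funext => s; rewrite exprfctE.
by have := is_deriveX n.+1 (is_derive_id t 1); rewrite [_ *: 1]mulr1.
Qed.

(** The real mean value theorem for the component of [F] in the direction of its
    increment [u], compared with [cmod u * B]. *)
Lemma curve_mean_value F F' (B B' : R -> R) :
  (forall t, 0 <= t <= 1 -> curve_derive F t (F' t)) ->
  (forall t, 0 <= t <= 1 -> is_derive t 1 B (B' t)) ->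
  (forall t, 0 <= t <= 1 -> cmod (F' t) <= B' t) ->
  cmod (F 1 - F 0) <= B 1 - B 0.
Proof.
move=> Fd Bd FB; set u := F 1 - F 0.
have [a [b uE]] : exists a b, u = a +i* b by case: (u) => a b; exists a, b.
pose phi t := a * complex.Re (F t) + b * complex.Im (F t) - cmod u * B t.
pose phi' t := a * complex.Re (F' t) + b * complex.Im (F' t) - cmod u * B' t.
have phid t : t \in `]0, 1[ -> is_derive t 1 phi (phi' t).
  rewrite in_itv/= => /andP[t0 t1]; have t01 : 0 <= t <= 1 by rewrite !ltW.
  have [F1 F2] := Fd t t01.
  exact: (is_deriveB (is_deriveD (is_deriveZ a F1) (is_deriveZ b F2))
    (is_deriveZ (cmod u) (Bd t t01))).
have phic : {within `[0, 1], continuous phi}.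
  apply: derivable_within_continuous => t; rewrite in_itv/= => t01.
  have [F1 F2] := Fd t t01.
  by case: (is_deriveB (is_deriveD (is_deriveZ a F1) (is_deriveZ b F2))
    (is_deriveZ (cmod u) (Bd t t01))).
have Bc : {within `[0, 1], continuous B}.
  by apply: derivable_within_continuous => t; rewrite in_itv/= => /Bd[].
have Bd' t : t \in `]0, 1[ -> is_derive t 1 B (B' t).
  by rewrite in_itv/= => /andP[t0 t1]; apply: Bd; rewrite !ltW.
have [s] := MVT ltr01 phid phic; rewrite in_itv/= subr0 mulr1 => /andP[s0 s1].
have s01 : 0 <= s <= 1 by rewrite !ltW.
have [r] := MVT ltr01 Bd' Bc; rewrite in_itv/= subr0 mulr1 => /andP[r0 r1] BE.
have r01 : 0 <= r <= 1 by rewrite !ltW.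
have B01 : 0 <= B 1 - B 0 by rewrite BE; apply: le_trans (FB _ r01); exact: cmod_ge0.
have phi's : phi' s <= 0.
  rewrite /phi' subr_le0.
  have -> : a * complex.Re (F' s) + b * complex.Im (F' s) =
      complex.Re (u^*%C * F' s) by rewrite uE ReM /= mulNr opprK.
  apply: le_trans (Re_cmod _) _; rewrite cmodM.
  by rewrite cmodJ ler_wpM2l ?cmod_ge0// FB.
have [<-//|u0] := eqVneq 0 (cmod u).
have {}u0 : 0 < cmod u by rewrite lt_neqAle u0 cmod_ge0.
rewrite -(ler_pM2l u0) => phiE; rewrite -subr_le0; apply: le_trans phi's.
rewrite -phiE /phi.
have -> : cmod u * cmod u = a * (complex.Re (F 1) - complex.Re (F 0)) +
    b * (complex.Im (F 1) - complex.Im (F 0)).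
  by rewrite -ReB -ImB -/u -expr2 cmod_sqr uE/= !expr2.
by rewrite le_eqVlt; apply/orP; left; apply/eqP; ring.
Qed.

End curves.

Section exponential.
Variable R : realType.
Local Notation C := R[i].
Implicit Types (x y z w : C).

Lemma cexpD z w : cexp (z + w) = cexp z * cexp w.
Proof.
case: z w => a b [c d]; apply: complex_eq; rewrite ?(ReM, ImM) /= expRD;
  by rewrite ?cosD ?sinD; ring.
Qed.

Lemma cexp0 : cexp (0 : C) = 1.
Proof. by rewrite /cexp /= expR0 cos0 sin0 mulr1 mulr0. Qed.

Lemma cexp_real (a : R) : cexp a%:C = (expR a)%:C.
Proof. by rewrite /cexp /= cos0 sin0 mulr1 mulr0. Qed.

Lemma cmod_cexp z : cmod (cexp z) = expR (complex.Re z).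
Proof.
case: z => a b; apply/eqP.
rewrite -(eqrXn2 (_ : (0 < 2)%N)) ?cmod_ge0 ?expR_ge0// cmod_sqr /= !exprMn.
by rewrite -mulrDr cos2Dsin2 mulr1.
Qed.

Lemma cexp_derive_ray z t :
  curve_derive (fun s => cexp (s%:C * z)) t (z * cexp (t%:C * z)).
Proof.
case: z => a b.
have lin (k : R) : is_derive t 1 (fun v : R => v * k) k.
  rewrite (_ : (fun v => _) = (fun v => k *: v)); last first.
    by apply/funext => s; exact: mulrC.
  by have := is_deriveZ k (is_derive_id t 1); rewrite [k *: 1]mulr1.
have E : is_derive t 1 (fun v => expR (v * a)) (a * expR (t * a)).
  by have := @is_derive1_comp _ expR (fun v => v * a) t _ _ (is_derive_expR _) (lin a); rewrite mulrC.
have Co : is_derive t 1 (fun v => cos (v * b)) (- sin (t * b) * b).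
  exact: (@is_derive1_comp _ cos (fun v => v * b) t _ _ (is_derive_cos _) (lin b)).
have Si : is_derive t 1 (fun v => sin (v * b)) (cos (t * b) * b).
  exact: (@is_derive1_comp _ sin (fun v => v * b) t _ _ (is_derive_sin _) (lin b)).
split=> /=.
  under eq_fun do rewrite !mul0r subr0 addr0.
  apply: (is_derive_eq (is_deriveM E Co)).
  rewrite !mul0r !subr0 !addr0 -![_ *: _]/(_ * _); ring.
under eq_fun do rewrite !mul0r subr0 addr0.
apply: (is_derive_eq (is_deriveM E Si)).
rewrite !mul0r !subr0 !addr0 -![_ *: _]/(_ * _); ring.
Qed.

Definition exp_partial (n : nat) z : C := \sum_(k < n) k`!%:R^-1 * z ^+ k.

Lemma exp_partial_derive_ray n z t :
  curve_derive (fun s => exp_partial n.+1 (s%:C * z)) t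
    (z * exp_partial n (t%:C * z)).
Proof.
elim: n => [|n IH].
  rewrite /exp_partial big_ord0 mulr0.
  under eq_fun do rewrite big_ord_recl big_ord0 expr0 addr0 mulr1.
  by split => /=; exact: is_derive_cst.
rewrite /exp_partial; under eq_fun do rewrite big_ord_recr /=.
rewrite big_ord_recr /= mulrDr; apply: curve_deriveD; first exact: IH.
have := @curve_derive_real R (fun s => s ^+ n.+1) t _
  ((n.+1)`!%:R^-1 * z ^+ n.+1) (is_derive_pow n t).
under eq_fun do rewrite rmorphXn/= mulrCA -exprMn.
set d := (X in curve_derive _ _ X -> _); set d' := (X in _ -> curve_derive _ _ X).
suff -> : d = d' by [].
rewrite /d /d' factS natrM invfM rmorphM/= rmorphXn/= rmorph_nat.
rewrite exprMn exprS; field.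
by rewrite nat1r !pnatr_eq0 -lt0n fact_gt0.
Qed.

(** By induction on [n]: along the ray from 0 to [z], the derivative of the
    remainder of order [n.+1] is [z] times the remainder of order [n]. *)
Lemma exp_partial_bound n z : cmod (cexp z - exp_partial n z) <=
  expR (cmod z) * cmod z ^+ n / n`!%:R.
Proof.
elim: n z => [|n IH] z.
  rewrite /exp_partial big_ord0 subr0 expr0 mulr1 fact0 divr1 cmod_cexp.
  by rewrite ler_expR Re_cmod.
have zR s : (0 : R) <= s <= 1 -> expR (cmod (s%:C * z)) <= expR (cmod z).
  case/andP=> s0 s1; rewrite ler_expR cmodM cmod_real ger0_norm//.
  by rewrite ler_piMl// cmod_ge0.
pose B (s : R) := s ^+ n.+1 * (expR (cmod z) * cmod z ^+ n.+1 / (n.+1)`!%:R).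
pose B' (s : R) := s ^+ n * (expR (cmod z) * cmod z ^+ n.+1 / n`!%:R).
have Bd (s : R) : is_derive s 1 B (B' s).
  have := is_deriveZ (expR (cmod z) * cmod z ^+ n.+1 / (n.+1)`!%:R)
    (is_derive_pow n s).
  set f := (X in is_derive _ _ X _ -> _); set d := (X in is_derive _ _ _ X -> _).
  have -> : f = B by apply/funext => v; exact: mulrC.
  suff -> : d = B' s by [].
  rewrite /d /B' -[_ *: _]/(_ * _) factS natrM invfM.
  by field; rewrite nat1r !pnatr_eq0 -lt0n fact_gt0.
have FB (s : R) : 0 <= s <= 1 ->
    cmod (z * cexp (s%:C * z) - z * exp_partial n (s%:C * z)) <= B' s.
  move=> s01; have /andP[s0 s1] := s01.
  rewrite -mulrBr cmodM /B' exprS.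
  have z0 := cmod_ge0 z.
  apply: le_trans (ler_wpM2l z0 (IH (s%:C * z))) _.
  have -> : s ^+ n * (expR (cmod z) * (cmod z * cmod z ^+ n) / n`!%:R) =
    cmod z * (expR (cmod z) * cmod (s%:C * z) ^+ n / n`!%:R).
    by rewrite (cmodM s%:C) cmod_real ger0_norm// exprMn; ring.
  rewrite ler_wpM2l// ler_wpM2r ?invr_ge0 ?ler0n//.
  by rewrite ler_wpM2r ?exprn_ge0 ?cmod_ge0// zR.
have := curve_mean_value
  (fun s _ => curve_deriveB (cexp_derive_ray z s) (exp_partial_derive_ray n z s))
  (fun s _ => Bd s) FB.
rewrite /B expr0n/= !mul0r expr1n !mul1r subr0 cexp0.
rewrite [exp_partial _ 0]big_ord_recl big1 => [|i _]; last first.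
  by rewrite exprS mul0r mulr0.
by rewrite fact0 invr1 expr0 mulr1 addr0 subrr subr0.
Qed.

(** The remainder of order 2 at [w - z] is quadratic in [w - z]. *)
Lemma cdiff_cexp z : cdiff (@cexp R) z (cexp z).
Proof.
move=> e e0; pose K := cmod (cexp z) * expR 1.
have K0 : 0 < K by rewrite mulr_gt0 ?expR_gt0// cmod_cexp expR_gt0.
exists (Order.min 1 (e / K)); first by rewrite lt_min ltr01 divr_gt0.
move=> w; rewrite lt_min => /andP[w1 wK].
have -> : cexp w - cexp z - cexp z * (w - z) =
    cexp z * (cexp (w - z) - exp_partial 2 (w - z)).
  rewrite /exp_partial !big_ord_recl big_ord0 /= /bump /= !factS fact0.
  rewrite -{1}(subrK z w) addrC cexpD muln1 !invr1 !mul1r expr0 expr1; ring.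
rewrite cmodM; apply: le_trans (ler_wpM2l (cmod_ge0 _) (exp_partial_bound 2 _)) _.
have d0 := cmod_ge0 (w - z); set D := cmod (w - z) in w1 wK d0 *.
apply: le_trans (_ : K * D * D <= _).
  rewrite /K -!mulrA ler_wpM2l ?cmod_ge0// -expr2.
  apply: ler_pM; first exact: expR_ge0.
  - by rewrite !mulr_ge0// invr_ge0 ler0n.
  - by rewrite ler_expR; exact: ltW.
  - rewrite expr2 ler_wpM2l// ler_pdivrMr ?ltr0n//.
    by rewrite ler_peMr// ler1n.
rewrite ler_wpM2r// mulrC -ler_pdivlMr//; exact: ltW.
Qed.

Lemma cderivable_cexp z : cderivable (@cexp R) z.
Proof. by exists (cexp z); exact: cdiff_cexp. Qed.

Lemma cexpK z : 0 < complex.Re z -> cexp (clog z) = z.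
Proof.
move=> z0; have zn0 : 0 < cmod z := lt_le_trans z0 (Re_cmod z).
rewrite /cexp /= lnK ?posrE//; set q := _ / _.
have ca : cos (atan q) = complex.Re z / cmod z.
  rewrite cos_atan -[LHS]invrK -[RHS]invrK; congr (_^-1); rewrite invrK.
  rewrite invfM invrK.
  have -> : 1 + q ^+ 2 = (cmod z / complex.Re z) ^+ 2.
    by rewrite [RHS]exprMn cmod_sqr /q; field; rewrite lt0r_neq0.
  by rewrite sqrtr_sqr ger0_norm ?divr_ge0 ?ltW// mulrC.
have sa : sin (atan q) = complex.Im z / cmod z.
  have := atanK q; rewrite /tan => /(canRL (mulfVK _)) ->.
    by rewrite ca /q; field; rewrite !lt0r_neq0.
  by rewrite ca mulf_neq0 ?invr_neq0 ?lt0r_neq0.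
rewrite ca sa; apply: complex_eq => /=; field; by rewrite lt0r_neq0.
Qed.

Lemma ccont_real (K : C -> Prop) (f : R -> R) (g : C -> C) z :
  {for complex.Re (g z), continuous f} -> ccont K g z ->
  ccont K (fun w => (f (complex.Re (g w)))%:C) z.
Proof.
move=> fc gc e e0; have := fc => /cvgrPdist_lt /(_ e e0) [t /= t0 ft].
have [s s0 gs] := gc t t0; exists s => // w Kw ws.
rewrite -rmorphB cmod_real distrC; apply: ft => /=.
rewrite -ReB; apply: le_lt_trans (norm_Re_cmod _) _.
by rewrite cmodB gs.
Qed.

Lemma clog_cont z : 0 < complex.Re z -> ccont whole (@clog R) z.
Proof.
move=> z0; have zn0 : 0 < cmod z := lt_le_trans z0 (Re_cmod z).
have cm : ccont whole (fun w : C => (cmod w)%:C) z.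
  move=> e e0; exists e => // w _ wz; rewrite -rmorphB cmod_real.
  rewrite ltr_norml; apply/andP; split.
    by have := cmodB_ge z w; rewrite cmodB; lra.
  by have := cmodB_ge w z; lra.
have cre : ccont whole (fun w : C => (complex.Re w)%:C) z.
  move=> e e0; exists e => // w _ wz; rewrite -rmorphB cmod_real -ReB.
  exact: le_lt_trans (norm_Re_cmod _) wz.
have cim : ccont whole (fun w : C => (complex.Im w)%:C) z.
  move=> e e0; exists e => // w _ wz; rewrite -rmorphB cmod_real -ImB.
  exact: le_lt_trans (norm_Im_cmod _) wz.
have crei : ccont whole (fun w : C => (complex.Re w)%:C^-1) z.
  apply: (ccont_comp cre (g := fun w => w^-1)); apply: cderivable_cont.
  by apply: cderivableV; [rewrite -cmod_gt0 cmod_real normr_gt0 gt_eqF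
    |exact: cderivable_id].
have cq := ccontM cim crei.
have cl := @ccont_real whole (@ln R) (fun w => (cmod w)%:C) z (continuous_ln zn0) cm.
have ca := @ccont_real whole (@atan R)
  (fun w => (complex.Im w)%:C / (complex.Re w)%:C) z (@continuous_atan R _) cq.
apply: eq_ccont (ccontD cl (ccontM (ccont_cst whole 'i z) ca)) => // w _.
rewrite /clog [RHS]complexE -fmorphV -rmorphM.
by congr (_ + _); congr ('i * _).
Qed.

(** The derivative of an inverse function: [clog] is continuous, and the
    differentiability of [cexp] at [clog z] bounds [clog w - clog z] linearly. *)
Lemma cderivable_clog z : 0 < complex.Re z -> cderivable (@clog R) z.
Proof.
move=> z0; have zn0 : 0 < cmod z := lt_le_trans z0 (Re_cmod z).
exists z^-1 => e e0.
pose h := Order.min (cmod z / 2) (e * cmod z ^+ 2 / 2).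
have h0 : 0 < h by rewrite lt_min !divr_gt0// mulr_gt0// exprn_gt0.
have [t t0 et] := cdiff_cexp (clog z) h0.
have [s s0 ls] := clog_cont z0 t0.
exists (Order.min s (complex.Re z)); first by rewrite lt_min s0.
move=> w; rewrite lt_min => /andP[/(ls _ I)/et + wz].
have w0 : 0 < complex.Re w.
  have := norm_Re_cmod (w - z); rewrite ReB ler_norml => /andP[+ _].
  by move=> ?; lra.
rewrite !cexpK//; set L := clog w - clog z => LE.
have l0 := cmod_ge0 L; have d0 := cmod_ge0 (w - z).
have h1 : h <= cmod z / 2 by rewrite ge_min lexx.
have h2 : h <= e * cmod z ^+ 2 / 2 by rewrite ge_min lexx orbT.
have L1 : cmod L * (cmod z / 2) <= cmod (w - z).
  have := cmodB_ge (z * L) (w - z); rewrite cmodM (cmodB (z * L)) => H.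
  have := ler_wpM2r l0 h1; lra.
have zC : z != 0 by rewrite -cmod_gt0.
have -> : L - z^-1 * (w - z) = - z^-1 * (w - z - z * L) by field.
rewrite cmodM cmodN cmodV mulrC ler_pdivrMr//; apply: le_trans LE _.
apply: le_trans (ler_wpM2r l0 h2) _.
have -> : e * cmod z ^+ 2 / 2 * cmod L = e * cmod z * (cmod L * (cmod z / 2)).
  by ring.
rewrite [leRHS]mulrAC ler_wpM2l// mulr_ge0//; exact: ltW.
Qed.

End exponential.

(** * The mean value property and the maximum principle *)

Definition circle (R : realType) (w : R[i]) (r th : R) : R[i] :=
  w + r%:C * cexp (0 +i* th).

Section mean_value.
Variable R : realType.
Local Notation C := R[i].
Implicit Types (f g : C -> C) (w z : C) (r th : R).

Lemma circle2pi w r : circle w r (pi *+ 2) = circle w r 0.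
Proof. by rewrite /circle /cexp /= cos2pi sin2pi cos0 sin0. Qed.

Lemma cmod_circle w r th : 0 <= r -> cmod (circle w r th - w) = r.
Proof.
move=> r0; rewrite /circle addrC addKr cmodM cmod_cexp expR0 mulr1 cmod_real.
by rewrite ger0_norm.
Qed.

Lemma circle_expR w s th : circle w (expR s) th = w + cexp (s +i* th).
Proof.
by rewrite /circle -cexp_real -cexpD /=; congr (_ + cexp _);
  apply: complex_eq; rewrite /= ?addr0 ?add0r.
Qed.

Lemma ccont_path f (p : R -> C) y :
  (forall y', cmod (p y' - p y) <= `|y' - y|) -> ccont whole f (p y) ->
  {for y, continuous (fun y => complex.Re (f (p y)))} /\
  {for y, continuous (fun y => complex.Im (f (p y)))}.
Proof.
move=> pL fc; split; apply/cvgrPdist_lt => e /fc[t t0 ft];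
  exists t => //= y' yy; rewrite -?ReB -?ImB;
  [apply: le_lt_trans (norm_Re_cmod _) _|apply: le_lt_trans (norm_Im_cmod _) _];
  rewrite cmodB; apply: ft => //; apply: le_lt_trans (pL _) _; by rewrite distrC.
Qed.

Lemma complexB (a b c d : R) : (a +i* b) - (c +i* d) = (a - c) +i* (b - d).
Proof. by []. Qed.

Lemma cmod_imag (a : R) : cmod (0 +i* a) = `|a|.
Proof. by rewrite /cmod /= expr0n/= add0r sqrtr_sqr. Qed.

Section polar.
Variables (f : C -> C) (w : C) (r : R).
Hypotheses (r0 : 0 < r) (fc : ccont whole f w).
Hypothesis fd : forall z, 0 < cmod (z - w) <= r -> cderivable f z.

Let s1 := ln r.
(* The radial logarithmic coordinate is cut off at [ln r], so that [G] is
   continuous on the whole plane although [f] is controlled inside the disc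
   only. *)
Let clamp (u : C) : C := Order.min (complex.Re u) s1 +i* complex.Im u.
Let G (u : C) : C := f (w + cexp (clamp u)).

Let clampP u : 0 < cmod (w + cexp (clamp u) - w) <= r.
Proof.
rewrite addrC addKr cmod_cexp /= expR_gt0/= -[leRHS](lnK (_ : r \is Num.pos))//.
by rewrite ler_expR ge_min lexx orbT.
Qed.

Let clamp_id u : complex.Re u <= s1 -> clamp u = u.
Proof. by case: u => a b /= /min_idPl h; rewrite /clamp /= h. Qed.

Let clamp_cont u : ccont whole clamp u.
Proof.
move=> e e0; exists (e / 2) => [|v _ vu]; first by rewrite divr_gt0.
apply: le_lt_trans (cmod_ReIm _) _; rewrite /clamp complexB /= [e]splitr.
rewrite ler_ltD//; last by rewrite -ImB; apply: le_lt_trans (norm_Im_cmod _) vu.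
apply: le_trans (_ : `|complex.Re (v - u)| <= _); last first.
  exact: le_trans (norm_Re_cmod _) (ltW vu).
rewrite ReB !minEle; case: ifP => h1; case: ifP => h2 //.
- move: h1 h2 => h1 /negbT; rewrite -ltNge => h2.
  by rewrite !ler0_norm; lra.
- move: h1 h2 => /negbT; rewrite -ltNge => h1 h2.
  by rewrite !ger0_norm; lra.
- by rewrite subrr normr0.
Qed.

Let G_cont u : ccont whole G u.
Proof.
apply: ccont_comp; last exact/cderivable_cont/fd/clampP.
apply: ccontD; first exact: ccont_cst.
by apply: (ccont_comp (clamp_cont u)); apply: cderivable_cont; exact: cderivable_cexp.
Qed.

(** Goursat's lemma for [G] on rectangles of height [2 pi]: the horizontal sides
    cancel by periodicity, so the mean over the circle of radius [e^s] does not
    depend on [s], and it tends to the value at the centre when [s] decreases.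
    The mean is expressed by an antiderivative [A] instead of an integral. *)
Lemma mean_value_property (A : R -> R) :
  (forall th, 0 <= th <= pi *+ 2 ->
    is_derive th 1 A (complex.Re (f (circle w r th)))) ->
  A (pi *+ 2) - A 0 = complex.Re (f w) * (pi *+ 2).
Proof.
move=> Ad; have p0 : 0 <= pi *+ 2 :> R by rewrite mulrn_wge0// pi_ge0.
have vert x y : {for y, continuous (fun y => complex.Re (G (x +i* y)))}.
  have := @ccont_path G (fun y => x +i* y) y; case => //.
  by move=> y'; rewrite complexB subrr cmod_imag.
have hori y x : {for x, continuous (fun x => complex.Im (G (x +i* y)))}.
  have := @ccont_path G (fun x => x +i* y) x; case => //.
  by move=> x'; rewrite complexB subrr -[_ +i* 0]/((x' - x)%:C) cmod_real.
have /choice[AQ AQd] x := antiderivative (-1) (pi *+ 2 + 1) (vert x).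
have {}AQd x y : 0 <= y <= pi *+ 2 ->
    is_derive y 1 (AQ x) (complex.Re (G (x +i* y))).
  by move=> /andP[y0 y1]; apply: AQd; apply/andP; split; lra.
have Glt s th : s <= s1 -> G (s +i* th) = f (circle w (expR s) th).
  by move=> ss; rewrite /G clamp_id//= circle_expR.
have step s0 : s0 <= s1 ->
    AQ s1 (pi *+ 2) - AQ s1 0 = AQ s0 (pi *+ 2) - AQ s0 0.
  move=> s01; have /choice[AP APd] y := antiderivative (s0 - 1) (s1 + 1) (hori y).
  have {}APd x y : s0 <= x <= s1 ->
      is_derive x 1 (AP y) (complex.Im (G (x +i* y))).
    by move=> /andP[y0 y1]; apply: APd; apply/andP; split; lra.
  have side : AP (pi *+ 2) s1 - AP (pi *+ 2) s0 = AP 0 s1 - AP 0 s0.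
    apply: eq_derive_diff s01 (fun x xs => APd x _ xs) _ => x xs.
    have := APd x 0 xs; case/andP: xs => _ xs.
    by rewrite (Glt _ 0 xs) (Glt _ (pi *+ 2) xs) circle2pi.
  have Gd z : (s0 <= complex.Re z <= s1) && (0 <= complex.Im z <= pi *+ 2) ->
      exists d, forall e, 0 < e -> exists2 t, 0 < t & forall u,
        (s0 <= complex.Re u <= s1) && (0 <= complex.Im u <= pi *+ 2) ->
        cmod (u - z) < t -> cmod (G u - G z - d * (u - z)) <= e * cmod (u - z).
    move=> /andP[/andP[zx0 zx1] _].
    have zd : cderivable (fun u => f (w + cexp u)) z.
      apply: cderivable_comp; last first.
        by apply: fd; have := clampP z; rewrite clamp_id.
      by apply: cderivableD; [exact: cderivable_cst|exact: cderivable_cexp].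
    case: zd => d zd; exists d => e /zd[t t0 zt]; exists t => // u.
    by move=> /andP[/andP[ux0 ux1] _] ut; rewrite /G !clamp_id//; exact: zt.
  have := @goursat R G (fun x y => AP y x) AQ s0 s1 0 (pi *+ 2) s01 p0 Gd
    (fun x y xs _ => APd x y xs) (fun x y _ ys => AQd x y ys).
  by move: side; set a := AQ _ _; set b := AQ _ _; set c := AQ _ _; lra.
have -> : A (pi *+ 2) - A 0 = AQ s1 (pi *+ 2) - AQ s1 0.
  apply: eq_derive_diff p0 Ad _ => th th0; have := AQd s1 th th0.
  by rewrite Glt// /s1 lnK.
apply/eqP; rewrite -subr_eq0 -normr_le0; apply/ler_addgt0Pr => e e0.
rewrite add0r; pose e' := e / (pi *+ 2 + 1).
have e'0 : 0 < e' by rewrite divr_gt0// ltr_wpDl.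
have [t t0 ft] := fc e'0.
pose s0 := Order.min s1 (ln (t / 2)).
have s0t : expR s0 < t.
  apply: le_lt_trans (_ : t / 2 < t); last by lra.
  rewrite -[leRHS](lnK (_ : t / 2 \is Num.pos)) ?posrE ?divr_gt0// ler_expR.
  by rewrite ge_min lexx orbT.
have s01 : s0 <= s1 by rewrite ge_min lexx.
rewrite (step _ s01).
have Kd th : 0 <= th <= pi *+ 2 -> is_derive th 1
    (fun v => AQ s0 v - complex.Re (f w) * v)
    (complex.Re (G (s0 +i* th)) - complex.Re (f w)).
  by move=> th0; exact: (is_deriveB (AQd s0 th th0) (is_derive_linear _ th)).
have Kb th : 0 <= th <= pi *+ 2 ->
    `|complex.Re (G (s0 +i* th)) - complex.Re (f w)| <= e'.
  move=> _; rewrite -ReB; apply: le_trans (norm_Re_cmod _) _.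
  by rewrite Glt//; apply/ltW/ft; rewrite // cmod_circle ?expR_ge0.
have := mean_value_le p0 Kd Kb.
rewrite mulr0 !subr0 (_ : _ - (AQ s0 0) =
  AQ s0 (pi *+ 2) - AQ s0 0 - complex.Re (f w) * (pi *+ 2)); last by ring.
move/le_trans; apply.
by rewrite /e' mulrAC ler_pdivrMr ?ltr_wpDl// ler_pM2l// lerDl.
Qed.

Lemma circle_cont : continuous (fun th => complex.Re (f (circle w r th))).
Proof.
have rE u : circle w r u = w + cexp (s1 +i* u).
  by rewrite -circle_expR /s1 lnK.
have E u : f (circle w r u) = G (s1 +i* u).
  by rewrite /G clamp_id//= rE.
rewrite (_ : (fun th => _) = fun th => complex.Re (G (s1 +i* th))); last first.
  by apply/funext => u; rewrite E.
move=> th; have := @ccont_path G (fun y => s1 +i* y) th; case => //.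
by move=> y'; rewrite complexB subrr cmod_imag.
Qed.

(** A harmonic function that equals its mean over a circle and is bounded by
    that mean there takes the same value somewhere on the right half of the
    circle. *)
Lemma mean_value_max M : complex.Re (f w) = M ->
  (forall th, complex.Re (f (circle w r th)) <= M) ->
  exists2 th, 0 < cos th & complex.Re (f (circle w r th)) = M.
Proof.
move=> fw fM; have [A Ad] := antiderivative (-1) (pi *+ 2 + 1) circle_cont.
have p2 : 2 <= pi :> R := @pi_ge2 R.
have {}Ad th : 0 <= th <= pi *+ 2 ->
    is_derive th 1 A (complex.Re (f (circle w r th))).
  by move=> /andP[t0 t1]; apply: Ad; apply/andP; split; lra.
have := mean_value_property Ad; rewrite fw => AE.
pose B v := M * v - A v.
have Bd th : 0 <= th <= pi *+ 2 ->
    is_derive th 1 B (M - complex.Re (f (circle w r th))).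
  by move=> th0; exact: (is_deriveB (is_derive_linear M th) (Ad th th0)).
have mono a b : 0 <= a -> a <= b -> b <= pi *+ 2 -> B a <= B b.
  move=> a0 ab b2; apply: ge0_derive_le ab _ _ => [x /andP[x0 x1]|x _].
    by apply: Bd; apply/andP; split; lra.
  by rewrite subr_ge0.
have pp : 1 <= pi *+ 2 :> R by rewrite mulr2n; lra.
have B1 := mono 0 (1 / 2) (lexx _) ltac:(lra) ltac:(lra).
have B2 := mono (1 / 2) 1 ltac:(lra) ltac:(lra) pp.
have B3 := mono 1 (pi *+ 2) ltac:(lra) pp (lexx _).
have half1 : (1 / 2 : R) < 1 by lra.
have Bdo x : x \in `](1 / 2 : R), 1[ ->
    is_derive x 1 B (M - complex.Re (f (circle w r x))).
  by rewrite in_itv/= => /andP[x0 x1]; apply: Bd; apply/andP; split; lra.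
have Bc : {within `[(1 / 2 : R), 1], continuous B}.
  apply: derivable_within_continuous => x; rewrite in_itv/= => /andP[x0 x1].
  by have [] := Bd x ltac:(apply/andP; split; lra).
have [c] := MVT half1 Bdo Bc; rewrite in_itv/= => /andP[c0 c1] cE.
exists c; first by apply: cos_gt0_pihalf; apply/andP; split; lra.
suff : M - complex.Re (f (circle w r c)) = 0 by lra.
have : B 0 = B (pi *+ 2) by rewrite /B mulr0; lra.
by lra.
Qed.

End polar.

Lemma finite_isolated (E : seq C) w :
  exists2 t, 0 < t & forall z, z \in E -> z != w -> t <= cmod (z - w).
Proof.
elim: E => [|x E [t t0 tE]]; first by exists 1.
have [xw|xw] := eqVneq x w.
  exists t => // z; rewrite inE => /predU1P[->|zE]; first by rewrite xw eqxx.
  exact: tE.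
exists (Order.min t (cmod (x - w))).
  by rewrite lt_min t0 cmod_gt0 subr_eq0.
move=> z; rewrite inE => /predU1P[->|zE] zw; rewrite ge_min ?lexx ?orbT//.
by rewrite tE.
Qed.

Lemma disc_compact : compact (@disc R).
Proof.
rewrite (_ : @disc R = [set z : C | `|z| <= 1]); first exact: closed_disc_compact.
by apply/seteqP; split => z /=; rewrite /disc /= cmod_le rmorph1.
Qed.

Lemma cmod_within_continuous (K : set C) f : (forall z, K z -> ccont K f z) ->
  {within K, continuous (fun z => cmod (f z))}.
Proof.
move=> fc; rewrite subspace_continuousP => z Kz.
apply/cvgrPdist_lt => e e0; have [t t0 ft] := fc z Kz e e0.
apply/near_cmod; exists t => // u uz Ku; have {}ft := ft u Ku uz.
rewrite distrC ltr_norml /from_subspace /=; apply/andP; split.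
  by have := cmodB_ge (f z) (f u); rewrite cmodB; lra.
by have := cmodB_ge (f u) (f z); lra.
Qed.

Lemma disc_max f : (forall z, disc z -> ccont (@disc R) f z) ->
  exists2 c, disc c & forall z, disc z -> cmod (f z) <= cmod (f c).
Proof.
move=> fc; have D0 : (@disc R) !=set0 by exists 0; rewrite /disc /= cmod0.
have [c /set_mem Kc cM] := compact_EVT_max D0 disc_compact
  (cmod_within_continuous fc).
by exists c => // z Kz; apply: cM; rewrite inE.
Qed.

(** Among the points where [cmod h] is maximal take one with the largest real
    part. The mean value property around it produces another maximum point
    further to the right. The exceptional points are there for the two uses of the
    principle: functions cut off to zero, and difference quotients, which have
    finitely many singularities [E]. *)
Lemma maximum_principle h (E : seq C) (B : R) :
  (forall z, disc z -> ccont (@disc R) h z) ->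
  (forall z, cmod z < 1 -> h z != 0 -> z \notin E -> cderivable h z) ->
  (forall z, cmod z = 1 -> cmod (h z) <= B) ->
  forall z, disc z -> cmod (h z) <= B.
Proof.
move=> hc hd hB z Dz; rewrite leNgt; apply/negP => zB.
have [c Dc cM] := disc_max hc; set M := cmod (h c) in cM.
have BM : B < M := lt_le_trans zB (cM z Dz).
have B0 : 0 <= B by apply: le_trans (hB 1 _); rewrite ?cmod_ge0 ?cmod1.
have M0 : 0 < M by lra.
pose K' := [set u : C | disc u /\ cmod (h u) = M].
have K'c : compact K'.
  apply: subclosed_compact disc_compact _ => [|u []//].
  rewrite -[X in closed X]setCK; apply: open_closedC; rewrite openE => u nK'.
  have [Du|] := boolP (cmod u <= 1); last first.
    rewrite -ltNge => u1; apply/near_cmod; exists (cmod u - 1).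
      by lra.
    move=> v vu [Dv _]; move: Dv; rewrite /disc/= => Dv.
    by have := cmodB_ge u v; rewrite cmodB; lra.
  have hu : cmod (h u) < M.
    rewrite lt_neqAle cM// andbT; apply/eqP => huM; exact: nK'.
  have [t t0 ht] := hc u Du (M - cmod (h u)) ltac:(lra).
  apply/near_cmod; exists t => // v vu [Dv hv].
  have := ht v Dv vu; have := cmodB_ge (h v) (h u); rewrite hv; lra.
have Rec : {within K', continuous (fun u : C => complex.Re u)}.
  apply: continuous_subspaceT => u; apply: (cvgrPdist_lt (F := nbhs u) _ _).2 => e e0.
  apply/near_cmod; exists e => // v vu; rewrite -ReB.
  by apply: le_lt_trans (norm_Re_cmod _) _; rewrite cmodB.
have [w /set_mem [Dw hw] wM] := compact_EVT_max (ex_intro _ c (conj Dc erefl))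
  K'c Rec.
have w1 : cmod w < 1.
  rewrite lt_neqAle Dw andbT; apply/eqP => /hB; rewrite hw; lra.
have hw0 : h w != 0 by rewrite -cmod_gt0 hw.
have [t1 t10 tE] := finite_isolated E w.
have [t2 t20 th] := hc w Dw M M0.
pose r := Order.min (t1 / 2) (Order.min (t2 / 2) ((1 - cmod w) / 2)).
have r0 : 0 < r by rewrite !lt_min !divr_gt0 // subr_gt0.
have r1 : r <= t1 / 2 by rewrite ge_min lexx.
have r2 : r <= t2 / 2 by rewrite !ge_min lexx !orbT.
have r3 : r <= (1 - cmod w) / 2 by rewrite !ge_min lexx !orbT.
have near1 u : cmod (u - w) <= r -> cmod u < 1.
  by move=> uw; have := cmodB_ge u w; lra.
(* [h] rotated so that its value at [w] is its modulus, up to a factor *)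
pose k (u : C) := (h w)^*%C * h u.
have kd u : 0 < cmod (u - w) <= r -> cderivable k u.
  move=> /andP[u0 ur]; apply: cderivableM; first exact: cderivable_cst.
  apply: hd; first exact: near1.
  - have Du : disc u by rewrite /disc/= ltW// near1.
    have := th u Du ltac:(lra); have := cmodB_ge (h w) (h u).
    by rewrite -cmod_gt0 hw cmodB; lra.
  - apply/negP => uE; have := tE u uE.
    by rewrite -subr_eq0 -cmod_gt0 => /(_ u0); lra.
have kc : ccont whole k w.
  apply: ccontM; first exact: ccont_cst.
  move=> e e0; have [t t0 ht] := hc w Dw e e0.
  exists (Order.min t r); first by rewrite lt_min t0.
  move=> u _; rewrite lt_min => /andP[ut ur]; apply: ht => //.
  by rewrite /disc/= ltW// near1// ltW.
have kw : complex.Re (k w) = M ^+ 2.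
  by rewrite -hw cmod_sqr /k ReM; case: (h w) => a b /=; ring.
have kM u : disc u -> complex.Re (k u) <= M * cmod (h u).
  by move=> Du; apply: le_trans (Re_cmod _) _; rewrite cmodM cmodJ hw.
have cD v : disc (circle w r v).
  by apply/ltW/near1; rewrite cmod_circle//; exact: ltW.
have [v|v cv kv] := mean_value_max r0 kc kd kw.
  apply: le_trans (kM _ (cD v)) _; rewrite expr2 ler_pM2l//.
  exact: cM.
have vK : K' (circle w r v).
  split; first exact: cD.
  apply/eqP; rewrite eq_le cM//=.
  by have := kM _ (cD v); rewrite kv expr2 ler_pM2l.
have := wM (circle w r v); rewrite inE => /(_ vK).
rewrite /circle ReD ReM /= expR0 !mul1r mul0r subr0.
by have := mulr_gt0 r0 cv; lra.
Qed.

End mean_value.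

(** * Division by a linear factor *)

(** The disc algebra as functions on the whole plane, of which only the values on
    the closed disc are constrained. *)
Definition holo (R : realType) (f : R[i] -> R[i]) :=
  (forall z, disc z -> ccont (@disc R) f z) /\
  (forall z, cmod z < 1 -> cderivable f z).

Definition dquot (R : realType) (f : R[i] -> R[i]) (w d z : R[i]) : R[i] :=
  if z == w then d else (f z - f w) / (z - w).

Section division.
Variable R : realType.
Local Notation C := R[i].
Implicit Types (f : C -> C) (w z d : C) (E : seq C).

Lemma dquotE f w d z : z != w -> dquot f w d z = (f z - f w) / (z - w).
Proof. by rewrite /dquot => /negbTE->. Qed.

Lemma dquotM f w d z : f z = f w + (z - w) * dquot f w d z.
Proof.
have [->|zw] := eqVneq z w; first by rewrite subrr mul0r addr0.
by rewrite dquotE//; field; rewrite subr_eq0.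
Qed.

Lemma dquotC f w d z d' : z != w -> dquot f w d z = dquot f z d' w.
Proof.
move=> zw; rewrite !dquotE//; last by rewrite eq_sym.
by rewrite -(opprB z) invrN mulrN -mulNr opprB.
Qed.

Lemma near_neq z w : z != w ->
  exists2 t : R, 0 < t & forall u, cmod (u - z) < t -> u != w.
Proof.
move=> zw; exists (cmod (w - z)); first by rewrite cmod_gt0 subr_eq0 eq_sym.
by move=> u uz; apply/eqP => uw; move: uz; rewrite uw ltxx.
Qed.

Lemma dquot_derivable f w d z : z != w -> cderivable f z ->
  cderivable (dquot f w d) z.
Proof.
move=> zw fz; have [t t0 tw] := near_neq zw.
apply: (@near_cderivable _ (fun u => (f u - f w) * (u - w)^-1) _ _ _ t0).
  by move=> u /tw uw; rewrite dquotE.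
apply: cderivableM; first by apply: cderivableB => //; exact: cderivable_cst.
apply: cderivableV; first by rewrite subr_eq0.
by apply: cderivableB; [exact: cderivable_id|exact: cderivable_cst].
Qed.

Lemma dquot_cont f w d z : disc z -> (forall z, disc z -> ccont (@disc R) f z) ->
  cdiff f w d -> ccont (@disc R) (dquot f w d) z.
Proof.
move=> Dz fc fd; have [->|zw] := eqVneq z w.
  move=> e e0; have [t t0 ft] := fd (e / 2) ltac:(by rewrite divr_gt0).
  exists t => // u Du ut; have [->|uw] := eqVneq u w; first by rewrite subrr cmod0.
  have uw0 : u - w != 0 by rewrite subr_eq0.
  rewrite dquotE// /dquot eqxx.
  rewrite (_ : _ - _ = (f u - f w - d * (u - w)) / (u - w)); last by field.
  rewrite cmodM cmodV ltr_pdivrMr ?cmod_gt0//; apply: le_lt_trans (ft _ ut) _.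
  by rewrite ltr_pM2r ?cmod_gt0//; lra.
have [t t0 tw] := near_neq zw.
have H : ccont (@disc R) (fun u => (f u - f w) * (u - w)^-1) z.
  apply: ccontM; first by apply: ccontB; [exact: fc|exact: ccont_cst].
  apply/ccontW/cderivable_cont/cderivableV; first by rewrite subr_eq0.
  by apply: cderivableB; [exact: cderivable_id|exact: cderivable_cst].
move=> e /H[s s0 hs]; exists (Order.min s t); first by rewrite lt_min s0.
move=> u Du; rewrite lt_min => /andP[us ut].
by rewrite !dquotE//; [exact: hs|exact: tw].
Qed.

Lemma cmod_sub_ge z w rho : cmod z = 1 -> cmod w <= rho -> 1 - rho <= cmod (z - w).
Proof. by move=> z1 wr; have := cmodB_ge z w; rewrite z1; lra. Qed.

(** Difference quotients with nearby base points are uniformly close: on the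
    unit circle this is an explicit computation, and the maximum principle
    carries it inside. *)
Lemma dquot_lipschitz f E (M L rho : R) w w' d d' :
  (forall z, disc z -> ccont (@disc R) f z) ->
  (forall z, cmod z < 1 -> z \notin E -> cderivable f z) ->
  (forall z, disc z -> cmod (f z) <= M) -> rho < 1 ->
  cmod w <= rho -> cmod w' <= rho -> cdiff f w d -> cdiff f w' d' ->
  cmod (f w' - f w) <= L * cmod (w - w') ->
  forall z, disc z -> cmod (dquot f w d z - dquot f w' d' z) <=
    (2 * L + 2 * M) / (1 - rho) ^+ 2 * cmod (w - w').
Proof.
move=> fc fd fM r1 wr wr' dw dw' fL; have r0 : 0 < 1 - rho by lra.
have w1 : disc w by rewrite /disc/=; lra.
have w'1 : disc w' by rewrite /disc/=; lra.
apply: (@maximum_principle _ _ (w :: w' :: E)) => z.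
- by move=> Dz; apply: ccontB; exact: dquot_cont.
- move=> z1 _; rewrite !inE !negb_or => /and3P[zw zw' zE].
  by apply: cderivableB; apply: dquot_derivable => //; exact: fd.
move=> z1; have D z2 : disc z2 -> cmod (z - z2) <= 2.
  by rewrite /disc/= => h; apply: le_trans (cmodD_le _ _) _; lra.
have a1 := cmod_sub_ge z1 wr; have a2 := cmod_sub_ge z1 wr'.
have zw0 : z - w != 0 by rewrite -cmod_gt0; lra.
have zw'0 : z - w' != 0 by rewrite -cmod_gt0; lra.
have zw : z != w by rewrite -subr_eq0.
have zw' : z != w' by rewrite -subr_eq0.
rewrite !dquotE//.
rewrite [X in cmod X](_ : _ = ((f w' - f w) * (z - w') + (f z - f w') * (w - w')) /
  ((z - w) * (z - w'))); last by field; rewrite zw'0.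
rewrite cmodM cmodV cmodM.
have f2 : cmod (f z - f w') <= 2 * M.
  apply: le_trans (cmodD_le _ _) _.
  by have := fM z ltac:(by rewrite /disc/= z1); have := fM w' w'1; lra.
have W := cmod_ge0 (w - w').
rewrite ler_pdivrMr; last by rewrite mulr_gt0//; lra.
apply: le_trans (_ : (2 * L + 2 * M) * cmod (w - w') <= _).
  apply: le_trans (cmodD _ _) _; rewrite !cmodM mulrDl lerD//.
    apply: le_trans (_ : cmod (f w' - f w) * 2 <= _).
      by rewrite ler_wpM2l ?cmod_ge0// D.
    by lra.
  exact: ler_wpM2r.
have LM : 0 <= (2 * L + 2 * M) * cmod (w - w').
  have := cmod_ge0 (f w' - f w); have := mulr_ge0 (le_trans (cmod_ge0 _) f2) W.
  by rewrite mulrDl; lra.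
have p0 : (1 - rho) ^+ 2 <= cmod (z - w) * cmod (z - w').
  by have r0' := ltW r0; rewrite expr2 ler_pM.
set c := cmod (w - w') in LM *; set P := cmod (z - w) * _ in p0 *.
have -> : (2 * L + 2 * M) / (1 - rho) ^+ 2 * c * P =
    (2 * L + 2 * M) * c * (P / (1 - rho) ^+ 2) by ring.
by rewrite ler_peMr// ler_pdivlMr ?mul1r ?exprn_gt0.
Qed.

(** Since [u t + K t] is nondecreasing, its infimum is the limit of [u] at 0. *)
Lemma lipschitz_limit (u : R -> R) (K r : R) : 0 < r ->
  (forall s t, 0 < s <= r -> 0 < t <= r -> `|u s - u t| <= K * `|s - t|) ->
  exists l, forall t, 0 < t <= r -> `|u t - l| <= K * t.
Proof.
move=> r0 uL.
pose S := [set u t + K * t | t in [set t | 0 < t <= r]].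
have rr : 0 < r <= r by rewrite r0 lexx.
have K0 : 0 <= K.
  have r2 : 0 < r / 2 <= r by apply/andP; split; lra.
  have := le_trans (normr_ge0 _) (uL r (r / 2) rr r2).
  by rewrite pmulr_lge0// normr_gt0; apply/eqP; lra.
have low t : 0 < t <= r -> lbound S (u t - K * t).
  move=> tr _ [s /= sr <-].
  have := uL t s tr sr; rewrite ler_norml => /andP[h1 h2].
  move: tr sr => /andP[/ltW t0 _] /andP[/ltW s0 _].
  have := mulr_ge0 K0 t0; have := mulr_ge0 K0 s0.
  by move: h1 h2; case: (lerP t s) => ts; lra.
exists (inf S) => t tr; rewrite ler_norml; apply/andP; split.
  suff : inf S <= u t + K * t by lra.
  by apply: ge_inf; [exists (u r - K * r); exact: low|exists t].
suff : u t - K * t <= inf S by lra.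
by apply: lb_le_inf; [exists (u r + K * r), r|exact: low].
Qed.

(** The Lipschitz condition makes the difference quotients at [w] a Cauchy family.
    Their limit is first found along a real ray ending at [w]. *)
Lemma lipschitz_quotient_derivable f w (K r : R) : 0 < r ->
  (forall z z', 0 < cmod (z - w) <= r -> 0 < cmod (z' - w) <= r ->
    cmod (dquot f w 0 z - dquot f w 0 z') <= K * cmod (z - z')) ->
  cderivable f w.
Proof.
move=> r0 fL; pose s z := dquot f w 0 z.
have ray t : 0 < t <= r -> 0 < cmod (w + t%:C - w) <= r.
  by move=> /andP[t0 tr]; rewrite addrC addKr cmod_real ger0_norm ?t0// ltW.
have sL t t' : 0 < t <= r -> 0 < t' <= r ->
    cmod (s (w + t%:C) - s (w + t'%:C)) <= K * `|t - t'|.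
  move=> tr tr'; apply: le_trans (fL _ _ (ray _ tr) (ray _ tr')) _.
  by rewrite opprD addrACA subrr add0r -rmorphB cmod_real.
have [l1 l1P] := lipschitz_limit (u := fun t => complex.Re (s (w + t%:C))) r0
  (fun t t' h h' => le_trans (eq_ind _ (fun x => `|x| <= _) (norm_Re_cmod _) _
    (ReB _ _)) (sL t t' h h')).
have [l2 l2P] := lipschitz_limit (u := fun t => complex.Im (s (w + t%:C))) r0
  (fun t t' h h' => le_trans (eq_ind _ (fun x => `|x| <= _) (norm_Im_cmod _) _
    (ImB _ _)) (sL t t' h h')).
exists (l1 +i* l2) => e e0.
have K0 : 0 <= K.
  have rr : 0 < r <= r by rewrite r0 lexx.
  have := l1P r rr; have := normr_ge0 (complex.Re (s (w + r%:C)) - l1) => h1 h2.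
  by have := le_trans h1 h2; rewrite pmulr_lge0.
pose t := Order.min r (e / (4 * K + 1)).
have t0 : 0 < t by rewrite lt_min r0 divr_gt0//; lra.
exists t => // z; rewrite lt_min => /andP[zr ze].
have [->|zw] := eqVneq z w; first by rewrite !subrr mulr0 subr0 cmod0 mulr0.
have zw0 : z - w != 0 by rewrite subr_eq0.
have D0 : 0 < cmod (z - w) by rewrite cmod_gt0.
have Dr : 0 < cmod (z - w) <= r by rewrite D0 ltW.
rewrite (_ : _ - _ = (s z - (l1 +i* l2)) * (z - w)); last first.
  by rewrite /s dquotE//; field.
rewrite cmodM ler_pM2r//.
have h1 := fL _ _ Dr (ray _ Dr).
have h2 : cmod (s (w + (cmod (z - w))%:C) - (l1 +i* l2)) <= 2 * K * cmod (z - w).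
  apply: le_trans (cmod_ReIm _) _; rewrite ReB ImB /=.
  by have := lerD (l1P _ Dr) (l2P _ Dr); rewrite /=; lra.
have h3 : cmod (z - (w + (cmod (z - w))%:C)) <= 2 * cmod (z - w).
  rewrite opprD addrA; apply: le_trans (cmodD_le _ _) _.
  by rewrite cmod_real ger0_norm ?cmod_ge0//; lra.
apply: le_trans (cmod_triangle _ (s (w + (cmod (z - w))%:C)) _) _.
have h4 := ler_wpM2l K0 h3.
move: ze; rewrite ltr_pdivlMr; last by lra.
by rewrite /s in h1 h2 *; lra.
Qed.

Lemma holo_bounded f : (forall z, disc z -> ccont (@disc R) f z) ->
  exists M, forall z, disc z -> cmod (f z) <= M.
Proof. by move=> /disc_max[c _ cM]; exists (cmod (f c)). Qed.

(** The removable singularity theorem for difference quotients. Twice, a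
    difference quotient inherits a Lipschitz bound by the maximum principle,
    first the one of [f] and then the one of the quotient itself, whose only
    possible singularity is [a]. *)
Lemma holo_division f a : holo f -> cmod a < 1 ->
  exists2 q, holo q & forall z, f z = f a + (z - a) * q z.
Proof.
move=> [fc fd] a1; have [da fda] := fd a a1.
exists (dquot f a da); last by move=> z; exact: dquotM.
have [M fM] := holo_bounded fc.
pose rho := (1 + cmod a) / 2.
have r1 : rho < 1 by rewrite /rho; lra.
have Dr z : cmod z <= rho -> disc z by rewrite /disc /=; lra.
have D1 z : cmod z <= rho -> cmod z < 1 by lra.
have M0 : 0 <= M by apply: le_trans (fM 0 _); rewrite ?cmod_ge0// /disc /= cmod0.
pose L := 2 * M / (1 - rho).
have qL w d : cmod w <= rho -> cdiff f w d ->
    forall z, disc z -> cmod (dquot f w d z) <= L.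
  move=> wr wd; apply: (@maximum_principle _ _ [:: w]) => z.
  - by move=> Dz; exact: dquot_cont.
  - by move=> z1 _; rewrite inE => zw; apply: dquot_derivable => //; exact: fd.
  move=> z1; have zw := cmod_sub_ge z1 wr.
  have zw0 : z != w by rewrite -subr_eq0 -cmod_gt0; lra.
  rewrite dquotE// cmodM cmodV /L; apply: ler_pM.
  - exact: cmod_ge0.
  - by rewrite invr_ge0 cmod_ge0.
  - apply: le_trans (cmodD_le _ _) _.
    have := fM z ltac:(by rewrite /disc/= z1).
    by have := fM w (Dr _ wr); lra.
  - by rewrite lef_pV2// posrE; lra.
have fL w z : cmod w <= rho -> disc z -> cmod (f z - f w) <= L * cmod (w - z).
  move=> wr Dz; have [d wd] := fd w (D1 _ wr).
  rewrite (dquotM f w d z) addrC addKr cmodM mulrC cmodB ler_wpM2r ?cmod_ge0//.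
  exact: qL.
have ar : cmod a <= rho by rewrite /rho; lra.
pose q := dquot f a da.
have qc z : disc z -> ccont (@disc R) q z by move=> Dz; exact: dquot_cont.
have qd z : cmod z < 1 -> z \notin [:: a] -> cderivable q z.
  by rewrite inE => z1 za; apply: dquot_derivable => //; exact: fd.
pose K := (2 * L + 2 * M) / (1 - rho) ^+ 2.
have qK z z' : cmod z <= rho -> cmod z' <= rho -> z != a -> z' != a ->
    cmod (q z' - q z) <= K * cmod (z - z').
  move=> zr zr' za za'; have [d zd] := fd z (D1 _ zr).
  have [d' zd'] := fd z' (D1 _ zr').
  rewrite cmodB /q (dquotC _ _ d za) (dquotC _ _ d' za').
  apply: (@dquot_lipschitz f [::]) => //; first by move=> u /fd.
  - exact: fL zr (Dr _ zr').
  - exact: Dr.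
pose K' := (2 * K + 2 * L) / (1 - rho) ^+ 2.
split=> // z z1; have [->|za] := eqVneq z a; last first.
  by apply: qd => //; rewrite inE.
apply: (@lipschitz_quotient_derivable q a K' ((1 - cmod a) / 2)).
  by rewrite divr_gt0// subr_gt0.
have near u : 0 < cmod (u - a) <= (1 - cmod a) / 2 -> cmod u <= rho /\ u != a.
  move=> /andP[u0 u1]; split; last by rewrite -subr_eq0 -cmod_gt0.
  by have := cmodB_ge u a; rewrite /rho; lra.
move=> u u' /near[ur ua] /near[ur' ua'].
have [d ud] := qd u (D1 _ ur) ltac:(by rewrite inE).
have [d' ud'] := qd u' (D1 _ ur') ltac:(by rewrite inE).
rewrite (dquotC _ _ d ua) (dquotC _ _ d' ua').
apply: (@dquot_lipschitz q [:: a]) => //.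
- by move=> v; exact: qL.
- exact: qK.
- exact: Dr.
Qed.

End division.

(** * Polynomials are dense *)

Section density.
Variable R : realType.
Local Notation C := R[i].
Implicit Types (f g : C -> C) (z : C).

Lemma shift_exists : exists S : (C -> C) -> (C -> C), forall f, holo f ->
  holo (S f) /\ forall z, f z = f 0 + z * S f z.
Proof.
have H f : exists q, holo f -> holo q /\ forall z, f z = f 0 + z * q z.
  have [hf|nf] := pselect (holo f); last by exists f.
  have [|q hq fq] := holo_division hf (a := 0); first by rewrite cmod0.
  by exists q => _; split=> // z; rewrite {1}fq subr0.
by have [S SP] := choice H; exists S.
Qed.

Lemma uniform_dilation f (e : R) : (forall z, disc z -> ccont (@disc R) f z) ->
  0 < e -> exists2 s : R, 0 < s < 1 &
    forall z, disc z -> cmod (f (s%:C * z) - f z) <= e.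
Proof.
move=> fc e0.
pose P (t : R) (z : C) := 0 <= t <= 1 -> disc z ->
  cmod (f ((1 - t)%:C * z) - f z) <= e.
have H : \forall t \near (0 : R), @disc R `<=` P t.
  have /compact_near_coveringP cov := @disc_compact R.
  apply: (cov R (nbhs (0 : R)) P).
  move=> z Dz; have [d d0 fd] := fc z Dz (e / 2) ltac:(by rewrite divr_gt0).
  exists ([set u | cmod (u - z) < d / 2], [set t : R | `|t| < d / 2]).
    split => /=.
      by apply/near_cmod; exists (d / 2) => //; rewrite divr_gt0.
    apply/nbhs_normP; exists (d / 2); first by rewrite /= divr_gt0.
    by move=> t; rewrite /ball_/= sub0r normrN.
  move=> [u t] /= [ud td] /andP[t0 t1] Du.
  have Du' : disc ((1 - t)%:C * u).
    rewrite /disc/= cmodM cmod_real ger0_norm; last by lra.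
    by rewrite mulr_ile1// ?cmod_ge0//; lra.
  have h1 := fd u Du ltac:(lra).
  have h2 : cmod ((1 - t)%:C * u - z) < d.
    apply: le_lt_trans (cmod_triangle _ u _) _.
    rewrite (_ : _ - u = - (t%:C * u)); last by rewrite rmorphB/= rmorph1; ring.
    rewrite cmodN cmodM cmod_real [d]splitr ler_ltD//.
    apply: le_trans (ltW td); by rewrite ler_piMr.
  have {}h2 := fd _ Du' h2.
  apply: le_trans (cmod_triangle _ (f z) _) _.
  by rewrite (cmodB (f z)); lra.
have /nbhs_normP[d /= d0 dP] := H.
pose t := Order.min (d / 2) (1 / 2).
have t0 : 0 < t by rewrite lt_min !divr_gt0.
have t1 : t <= 1 / 2 by rewrite ge_min lexx orbT.
have td : t <= d / 2 by rewrite ge_min lexx.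
exists (1 - t); first by apply/andP; split; lra.
move=> z Dz; have := dP t _ z Dz; rewrite /P /ball_/=; apply => //.
  by rewrite sub0r normrN gtr0_norm//; lra.
by apply/andP; split; lra.
Qed.

Section taylor.
Variables (f : C -> C) (S : (C -> C) -> (C -> C)) (M : R).
Hypothesis holo_f : holo f.
Hypothesis SP : forall g, holo g -> holo (S g) /\ forall z, g z = g 0 + z * S g z.
Hypothesis fM : forall z, disc z -> cmod (f z) <= M.

Let g n := iter n S f.
Let a n := g n 0.

Let holo_g n : holo (g n).
Proof. by elim: n => [//|n /SP[]]. Qed.

Let gS n z : g n z = a n + z * g n.+1 z.
Proof. by have [_ ->] := SP (holo_g n). Qed.

Lemma taylor_remainder n z :
  f z = \sum_(k < n) a k * z ^+ k + z ^+ n * g n z.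
Proof.
elim: n => [|n IH]; first by rewrite big_ord0 add0r mul1r.
by rewrite big_ord_recr /= -[S (g n)]/(g n.+1) {1}IH gS exprS; ring.
Qed.

Section coefficients.
Variable r : R.
Hypothesis r01 : 0 < r < 1.

Let r0 : 0 < r. Proof. by case/andP: r01. Qed.
Let r1 : r < 1. Proof. by case/andP: r01. Qed.

Let g_der n z : cmod (z - 0) <= r -> cderivable (g n) z.
Proof. by rewrite subr0 => zr; apply: (holo_g n).2; exact: le_lt_trans zr r1. Qed.

Let disc_circle th : disc (circle 0 r th).
Proof.
by rewrite /disc/= -[circle _ _ _]subr0 cmod_circle ltW.
Qed.

Let sq_cont n : continuous (fun th => cmod (g n (circle 0 r th)) ^+ 2).
Proof.
have gc k : ccont whole (fun u => k * g n u) 0.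
  apply: cderivable_cont; apply: cderivableM; first exact: cderivable_cst.
  by apply: g_der; rewrite subr0 cmod0 ltW.
have gd k z : 0 < cmod (z - 0) <= r -> cderivable (fun u => k * g n u) z.
  move=> /andP[_ zr]; apply: cderivableM; [exact: cderivable_cst|exact: g_der].
have Rec := circle_cont r0 (gd 1).
have Imc := circle_cont r0 (gd (- 'i)).
rewrite (_ : (fun th => _) = (fun th => complex.Re (1 * g n (circle 0 r th)) *
    complex.Re (1 * g n (circle 0 r th)) +
    complex.Re (- 'i * g n (circle 0 r th)) *
    complex.Re (- 'i * g n (circle 0 r th)))); last first.
  apply/funext => th; rewrite cmod_sqr mul1r; case: (g n _) => x y /=.
  by ring.
move=> th.
exact: (cvgD (cvgM (Rec th) (Rec th)) (cvgM (Imc th) (Imc th))).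
Qed.

(** Subtracting from [g n] its mean [a n] over the circle of radius [r] lowers the
    mean of [cmod (g n) ^+ 2] by [cmod (a n) ^+ 2], so the mean square of
    [r ^+ n * g n] decreases with [n]. *)
Let mean_square n : exists A : R -> R,
  (forall th, 0 <= th <= pi *+ 2 ->
    is_derive th 1 A (cmod (g n (circle 0 r th)) ^+ 2)) /\
  A (pi *+ 2) - A 0 <= (M / r ^+ n) ^+ 2 * (pi *+ 2) /\
  cmod (a n) ^+ 2 * (pi *+ 2) <= A (pi *+ 2) - A 0.
Proof.
have p0 : 0 <= pi *+ 2 :> R by rewrite mulrn_wge0// pi_ge0.
have sq n' (A : R -> R) : (forall th, 0 <= th <= pi *+ 2 ->
    is_derive th 1 A (cmod (g n' (circle 0 r th)) ^+ 2)) ->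
  exists2 B : R -> R, forall th, 0 <= th <= pi *+ 2 ->
    is_derive th 1 B (cmod (g n' (circle 0 r th) - a n') ^+ 2) &
    B (pi *+ 2) - B 0 = A (pi *+ 2) - A 0 - cmod (a n') ^+ 2 * (pi *+ 2).
  move=> Ad; pose k u := (a n')^*%C * g n' u.
  have kd z : 0 < cmod (z - 0) <= r -> cderivable k z.
    move=> /andP[_ zr]; apply: cderivableM; [exact: cderivable_cst|exact: g_der].
  have kc : ccont whole k 0.
    apply: cderivable_cont; apply: cderivableM; first exact: cderivable_cst.
    by apply: g_der; rewrite subr0 cmod0 ltW.
  have [A2 A2d] := antiderivative (-1) (pi *+ 2 + 1) (circle_cont r0 kd).
  have {}A2d th : 0 <= th <= pi *+ 2 ->
      is_derive th 1 A2 (complex.Re (k (circle 0 r th))).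
    by move=> /andP[t0 t1]; apply: A2d; apply/andP; split; lra.
  have A2E := mean_value_property r0 kc kd A2d.
  have k0 : complex.Re (k 0) = cmod (a n') ^+ 2.
    by rewrite cmod_sqr /k ReM -/(a n'); case: (a n') => x y /=; ring.
  exists (fun v => A v - 2 * A2 v + cmod (a n') ^+ 2 * v).
    move=> th th0; apply: is_derive_eq.
      exact: (is_deriveD (is_deriveB (Ad th th0) (is_deriveZ 2 (A2d th th0)))
        (is_derive_linear (cmod (a n') ^+ 2) th)).
    rewrite !cmod_sqr /k !(ReB, ImB, ReM).
    case: (a n') (g n' (circle 0 r th)) => x y [x' y'] /=.
    by rewrite (_ : _ *: _ = 2 * (x * x' - - y * y'))//; ring.
  by move: A2E; rewrite k0 mulr0 addr0 => A2E; move: A2E; lra.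
have fin (A : R -> R) n' : (forall th, 0 <= th <= pi *+ 2 ->
    is_derive th 1 A (cmod (g n' (circle 0 r th)) ^+ 2)) ->
    cmod (a n') ^+ 2 * (pi *+ 2) <= A (pi *+ 2) - A 0.
  move=> Ad; have [B Bd BE] := sq n' A Ad.
  have : B 0 <= B (pi *+ 2).
    by apply: ge0_derive_le p0 Bd _ => th _; exact: sqr_ge0.
  by move: BE; lra.
suff [A [Ad AM]] : exists A : R -> R,
  (forall th, 0 <= th <= pi *+ 2 ->
    is_derive th 1 A (cmod (g n (circle 0 r th)) ^+ 2)) /\
  A (pi *+ 2) - A 0 <= (M / r ^+ n) ^+ 2 * (pi *+ 2).
  by exists A; split=> //; split=> //; exact: fin.
elim: n => [|n [A [Ad AM]]].
  have [A Ad] := antiderivative (-1) (pi *+ 2 + 1) (@sq_cont 0).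
  have {}Ad th : 0 <= th <= pi *+ 2 ->
      is_derive th 1 A (cmod (g 0 (circle 0 r th)) ^+ 2).
    by move=> /andP[t0 t1]; apply: Ad; apply/andP; split; lra.
  exists A; split=> //; rewrite expr0 divr1.
  have Bd th : 0 <= th <= pi *+ 2 -> is_derive th 1 (fun v => M ^+ 2 * v - A v)
      (M ^+ 2 - cmod (g 0 (circle 0 r th)) ^+ 2).
    by move=> th0; exact: (is_deriveB (is_derive_linear (M ^+ 2) th) (Ad th th0)).
  have := ge0_derive_le p0 Bd; rewrite mulr0 => H.
  suff : 0 - A 0 <= M ^+ 2 * (pi *+ 2) - A (pi *+ 2) by lra.
  apply: H => th _; rewrite subr_ge0 ler_sqr ?nnegrE ?cmod_ge0//.
    exact: fM.
  exact: le_trans (cmod_ge0 _) (fM (disc_circle 0)).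
have [B Bd BE] := sq n A Ad.
exists (fun v => (r ^+ 2)^-1 * B v); split.
  move=> th th0; apply: is_derive_eq; first exact: (is_deriveZ _ (Bd th th0)).
  rewrite gS addrC addKr cmodM exprMn -{1}[circle 0 r th]subr0 cmod_circle ?ltW//.
  rewrite (_ : _ *: _ =
    (r ^+ 2)^-1 * (r ^+ 2 * cmod (g n.+1 (circle 0 r th)) ^+ 2))//.
  by rewrite mulKf// expf_neq0// lt0r_neq0.
rewrite -mulrBr BE.
have p2 : 0 <= cmod (a n) ^+ 2 * (pi *+ 2) by rewrite mulr_ge0 ?sqr_ge0.
have -> : (M / r ^+ n.+1) ^+ 2 * (pi *+ 2) =
    (r ^+ 2)^-1 * ((M / r ^+ n) ^+ 2 * (pi *+ 2)).
  by rewrite (exprS r n); field; rewrite expf_neq0 lt0r_neq0.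
by rewrite ler_wpM2l ?invr_ge0 ?sqr_ge0//; lra.
Qed.

Lemma taylor_coefficient n : cmod (a n) <= M / r ^+ n.
Proof.
have M0 : 0 <= M by exact: le_trans (cmod_ge0 _) (fM (disc_circle 0)).
have [A [_ [h1 h2]]] := mean_square n.
have := le_trans h2 h1; rewrite ler_pM2r; last by rewrite pmulrn_lgt0// pi_gt0.
by rewrite ler_sqr// nnegrE ?cmod_ge0// divr_ge0// exprn_ge0// ltW.
Qed.

(** On the unit circle the Taylor polynomial is bounded by a geometric sum; the
    maximum principle extends the bound to the disc. *)
Lemma taylor_remainder_bound n z : disc z ->
  cmod (g n z) <= M / r ^+ n / (1 - r).
Proof.
have M0 : 0 <= M by exact: le_trans (cmod_ge0 _) (fM (disc_circle 0)).
have [gc gd] := holo_g n.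
move: z; apply: (@maximum_principle _ _ [::]) => // [z z1 _ _|z z1].
  exact: gd.
have Dz : disc z by rewrite /disc/= z1.
suff H m : cmod (f z - \sum_(k < m) a k * z ^+ k) <= M / r ^+ m / (1 - r).
  have := H n; rewrite {1}(taylor_remainder n z) addrC addKr cmodM cmodX z1.
  by rewrite expr1n mul1r.
elim: m => [|m IH].
  rewrite big_ord0 subr0 expr0 divr1; apply: le_trans (fM Dz) _.
  by rewrite ler_pdivlMr ?subr_gt0// ler_piMr// gerBl ltW.
rewrite big_ord_recr /= opprD addrA; apply: le_trans (cmodD_le _ _) _.
rewrite cmodM cmodX z1 expr1n mulr1.
apply: le_trans (lerD IH (taylor_coefficient m)) _.
have rm : 0 < r ^+ m by rewrite exprn_gt0.
have -> : M / r ^+ m / (1 - r) + M / r ^+ m = M / r ^+ m / (1 - r) * (2 - r).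
  by field; rewrite !lt0r_neq0// subr_gt0.
have -> : M / r ^+ m.+1 / (1 - r) = M / r ^+ m / (1 - r) * r^-1.
  by rewrite exprS; field; rewrite !lt0r_neq0// subr_gt0.
rewrite ler_wpM2l//.
  by rewrite !divr_ge0// ?ltW// subr_gt0.
rewrite -[r^-1]mul1r (ler_pdivlMr _ _ r0).
have := sqr_ge0 (1 - r); rewrite expr2; lra.
Qed.

End coefficients.
End taylor.

(** The dilated function [f (s z)] is close to [f], and its Taylor remainder is at
    most a multiple of [(s / r) ^+ n] for every [r] between [s] and 1. *)
Lemma polynomial_density f (e : R) : holo f -> 0 < e ->
  exists p : {poly C}, forall z, disc z -> cmod (f z - p.[z]) <= e.
Proof.
move=> hf e0; have [fc _] := hf; have [M fM] := holo_bounded fc.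
have [S SP] := shift_exists.
have [s s01 fs] := uniform_dilation fc (e := e / 2) ltac:(by rewrite divr_gt0).
have /andP[s0 s1] := s01.
have M0 : 0 <= M by apply: le_trans (fM 0 _); rewrite ?cmod_ge0// /disc /= cmod0.
pose r := (1 + s) / 2.
have r01 : 0 < r < 1 by apply/andP; split; rewrite /r; lra.
have [r0 r1] := andP r01.
have sr : s < r by rewrite /r; lra.
have q1 : `|s / r| < 1.
  have sr0 : 0 < s / r by apply: divr_gt0.
  by rewrite (gtr0_norm sr0) ltr_pdivrMr// mul1r.
have := @cvg_geometric _ (M / (1 - r)) _ q1.
move=> /cvgrPdist_lt /(_ _ (divr_gt0 e0 (ltr0n R 2)))[n _ /(_ n)].
rewrite /= leqnn => /(_ isT); rewrite sub0r normrN => ns.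
exists (\poly_(k < n) (iter k S f 0 * s%:C ^+ k)) => z Dz.
apply: le_trans (cmod_triangle _ (f (s%:C * z)) _) _.
rewrite (cmodB (f z)) [e]splitr lerD ?fs//.
rewrite (taylor_remainder hf SP n (s%:C * z)) horner_poly.
rewrite [X in cmod X](_ : _ = (s%:C * z) ^+ n * iter n S f (s%:C * z)).
  rewrite cmodM cmodX cmodM cmod_real gtr0_norm//.
  have Dsz : disc (s%:C * z).
    rewrite /disc/= cmodM cmod_real gtr0_norm//.
    by rewrite mulr_ile1 ?cmod_ge0//; exact: ltW.
  have z0 := cmod_ge0 z.
  apply: le_trans (ler_wpM2l _ (taylor_remainder_bound hf SP fM r01 n Dsz)) _.
    by rewrite exprn_ge0// mulr_ge0// ltW.
  apply: le_trans (_ : s ^+ n * (M / r ^+ n / (1 - r)) <= _).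
    rewrite ler_wpM2r//.
      by rewrite !divr_ge0// ?exprn_ge0 ?subr_ge0// ltW.
    rewrite exprMn -[leRHS]mulr1 ler_wpM2l ?exprn_ge0 ?exprn_ile1//; exact: ltW.
  apply: le_trans (ltW ns); apply: le_trans (ler_norm _).
  rewrite /geometric /= (expr_div_n s r) le_eqVlt; apply/orP; left; apply/eqP.
  by field; rewrite !lt0r_neq0 ?exprn_gt0// subr_gt0.
rewrite addrAC (_ : \sum_(k < n) _ = \sum_(i < n) iter i S f 0 * s%:C ^+ i * z ^+ i).
  by rewrite subrr add0r.
by apply: eq_bigr => i _; rewrite exprMn mulrA.
Qed.

End density.

(** * Elements of the disc algebra *)

Definition ev (R : realType) (f : disc_algebra R) : R[i] -> R[i] :=
  disc_ext (disc_fun f).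

Section elements.
Variable R : realType.
Local Notation C := R[i].
Local Notation A := (disc_algebra R).
Implicit Types (f g u : A) (F : C -> C) (z k : C).

Lemma discE z : disc z <-> `|z| <= 1.
Proof. by rewrite /disc /= cmod_le rmorph1. Qed.

Lemma open_discE z : (cmod z < 1) = (`|z| < 1).
Proof. by rewrite cmod_lt rmorph1. Qed.

Lemma setdiscE : [set z : C | `|z| <= 1] = @disc R.
Proof. by apply/seteqP; split => z /discE. Qed.

Lemma in_disc_algebraP (f : closed_disc R -> C) :
  in_disc_algebra f <-> holo (disc_ext f).
Proof.
rewrite /in_disc_algebra setdiscE -ccont_within; split=> -[fc fd]; split=> // z z1.
  by apply/cderivableP/fd; rewrite -open_discE.
by apply/cderivableP/fd; rewrite open_discE.
Qed.

Lemma disc_ext_restrict F z : disc z ->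
  disc_ext ((fun v => F (val v)) : closed_disc R -> C) z = F z.
Proof. by move=> /discE Dz; rewrite /disc_ext insubT. Qed.

Lemma holo_restrict F : holo F ->
  ((fun v => F (val v)) : closed_disc R -> C) \in @disc_algebra_pred R.
Proof.
move=> [Fc Fd]; apply/asboolP/in_disc_algebraP; split=> z z1.
  apply: eq_ccont (Fc z z1) => // w Dw; by rewrite disc_ext_restrict.
apply: (@near_cderivable _ F _ z (1 - cmod z)); first by rewrite subr_gt0.
  move=> w wz; rewrite disc_ext_restrict// /disc/=.
  by have := cmodB_ge w z; lra.
exact: Fd.
Qed.

Definition disc_of F (hF : holo F) : A := DiscAlgebra (holo_restrict hF).


Lemma disc_ofE F (hF : holo F) z : disc z -> ev (disc_of hF) z = F z.
Proof. exact: disc_ext_restrict. Qed.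

Lemma holo_ev f : holo (ev f).
Proof. by apply/in_disc_algebraP/asboolP; exact: disc_funP. Qed.

Lemma disc_fun_ev f (v : closed_disc R) : f v = ev f (val v).
Proof. by rewrite /ev disc_extE. Qed.

Lemma disc_val (v : closed_disc R) : disc (val v).
Proof. by apply/discE; exact: valP v. Qed.

Lemma ev_inj f g : (forall z, disc z -> ev f z = ev g z) -> f = g.
Proof.
move=> fg; apply/val_inj/funext => u; rewrite /= !disc_fun_ev fg//.
exact: disc_val.
Qed.

Lemma evM f g z : ev (f * g) z = ev f z * ev g z.
Proof. by rewrite /ev [disc_fun _]/(disc_fun f * disc_fun g) disc_extM. Qed.

Lemma evB f g z : ev (f - g) z = ev f z - ev g z.
Proof. by rewrite /ev [disc_fun _]/(disc_fun f - disc_fun g) disc_extB. Qed.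

Lemma evD f g z : ev (f + g) z = ev f z + ev g z.
Proof. by have := evB (f + g) g z; rewrite addrK => ->; rewrite subrK. Qed.

Lemma ev0 z : ev 0 z = 0.
Proof. by have := evB 0 0 z; rewrite !subrr. Qed.

Lemma ev_sum (I : Type) (r : seq I) (F : I -> A) z :
  ev (\sum_(i <- r) F i) z = \sum_(i <- r) ev (F i) z.
Proof. exact: (big_morph (fun f => ev f z) (fun f g => evD f g z) (ev0 z)). Qed.

Lemma evN f z : ev (- f) z = - ev f z.
Proof. by rewrite -[- f]sub0r evB ev0 sub0r. Qed.

Definition dcst k : A := k%:A.

Lemma dcstE k : dcst k = k%:A. Proof. by []. Qed.

Lemma ev_dcst k z : disc z -> ev (dcst k) z = k.
Proof.
move=> /discE Dz; rewrite /ev /disc_ext insubT/=.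
exact: (mulr1 k).
Qed.

Lemma ev1 z : disc z -> ev 1 z = 1.
Proof. by move=> Dz; rewrite -[1 in LHS]scale1r (ev_dcst 1 Dz). Qed.

Lemma evX f n z : disc z -> ev (f ^+ n) z = ev f z ^+ n.
Proof.
move=> Dz; elim: n => [|n IH]; first by rewrite !expr0 ev1.
by rewrite !exprS evM IH.
Qed.

Lemma holo_comp F f : (forall z, disc z -> cderivable F (ev f z)) ->
  holo (fun z => F (ev f z)).
Proof.
move=> Fd; have [fc fd] := holo_ev f; split=> z z1.
  by apply: ccont_comp (fc z z1) _; exact/cderivable_cont/Fd.
by apply: cderivable_comp (fd z z1) _; apply: Fd; rewrite /disc/= ltW.
Qed.

Lemma holo_cexp f : holo (fun z => cexp (ev f z)).
Proof. by apply: (@holo_comp (@cexp R)) => z _; exact: cderivable_cexp. Qed.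

Definition dexp f : A := disc_of (holo_cexp f).

Lemma ev_dexp f z : disc z -> ev (dexp f) z = cexp (ev f z).
Proof. exact: disc_ofE. Qed.

Lemma dexpD f g : dexp (f + g) = dexp f * dexp g.
Proof. by apply: ev_inj => z Dz; rewrite evM !ev_dexp// evD cexpD. Qed.

Lemma dexp0 : dexp 0 = 1.
Proof. by apply: ev_inj => z Dz; rewrite ev_dexp// ev0 cexp0 ev1. Qed.

Lemma dexpN f : dexp (- f) * dexp f = 1.
Proof. by rewrite -dexpD addNr dexp0. Qed.

Lemma dinv_exists f : (forall z, disc z -> ev f z != 0) -> exists g, f * g = 1.
Proof.
move=> f0; have hi : holo (fun z => (ev f z)^-1).
  by apply: (@holo_comp (fun w => w^-1)) => z /f0 fz; apply: cderivableV => //;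
    exact: cderivable_id.
exists (disc_of hi); apply: ev_inj => z Dz.
by rewrite evM disc_ofE// ev1// mulfV// f0.
Qed.

Lemma dlog_exists u : (forall z, disc z -> 0 < complex.Re (ev u z)) ->
  exists g, u = dexp g.
Proof.
move=> u0; have hl : holo (fun z => clog (ev u z)).
  by apply: (@holo_comp (@clog R)) => z Dz; apply: cderivable_clog; exact: u0.
exists (disc_of hl); apply: ev_inj => z Dz.
by rewrite ev_dexp// disc_ofE// cexpK// u0.
Qed.

Lemma dlog_near1 u : (forall z, disc z -> cmod (ev u z) < 1) ->
  exists g, 1 - u = dexp g.
Proof.
move=> u1; apply: dlog_exists => z Dz; rewrite evB ev1// ReB /= subr_gt0.
exact: le_lt_trans (Re_cmod _) (u1 z Dz).
Qed.

Lemma clog_exists k : k != 0 -> exists l, k = cexp l.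
Proof.
have neg1 : -1 = cexp (0 +i* pi) :> C.
  by rewrite /cexp /= expR0 cospi sinpi mulr0 mul1r; apply: complex_eq;
    rewrite ?ReN ?ImN /= ?oppr0.
have H (u : C) : complex.Re u != 0 -> exists l, u = cexp l.
  rewrite neq_lt => /orP[u0|u0]; last by exists (clog u); rewrite cexpK.
  exists (clog (- u) + (0 +i* pi)); rewrite cexpD -neg1 cexpK ?mulrN1 ?opprK//.
  by rewrite ReN oppr_gt0.
move=> k0; have [kr|] := eqVneq (complex.Re k) 0; last exact: H.
have ki : complex.Re (- 'i * k) != 0.
  rewrite ReM /= !oppr0 mul0r sub0r mulN1r opprK.
  by apply: contra_neq k0 => ki; exact: complex_eq.
have [l lE] := H _ ki; exists (l + (0 +i* (pi / 2))); rewrite cexpD -lE.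
rewrite /cexp /= expR0 cos_pihalf sin_pihalf mulr0 mul1r.
by case: k {k0 kr ki lE} => x y; apply: complex_eq => /=; ring.
Qed.

Lemma dlog_cst k : k != 0 -> exists g, dcst k = dexp g.
Proof.
move=> /clog_exists[l ->]; exists (dcst l); apply: ev_inj => z Dz.
by rewrite ev_dexp// !ev_dcst.
Qed.

Lemma ev_bounded f : exists2 M : R, 0 < M & forall z, disc z -> cmod (ev f z) <= M.
Proof.
have [M fM] := holo_bounded (holo_ev f).1; exists (M + 1).
  apply: lt_le_trans (_ : 0 + 1 <= _); first by rewrite add0r.
  rewrite lerD2r; apply: le_trans (fM 0 _); first exact: cmod_ge0.
  by rewrite /disc/= cmod0.
by move=> z /fM /le_trans; apply; rewrite lerDl.
Qed.

Lemma holo_lin k : holo (fun z => z - k).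
Proof.
have H z : cderivable (fun z => z - k) z.
  by apply: cderivableB; [exact: cderivable_id|exact: cderivable_cst].
by split=> z _; [exact/ccontW/cderivable_cont|].
Qed.

Definition lin k : A := disc_of (holo_lin k).

Lemma ev_lin k z : disc z -> ev (lin k) z = z - k.
Proof. exact: disc_ofE. Qed.

(* Keeps rewriting from looking for sums and products inside these constants. *)
#[global] Opaque ev disc_of dexp dcst lin.

Lemma lin_outside k : 1 < cmod k -> exists g, lin k = dexp g.
Proof.
move=> k1; have k0 : k != 0 by rewrite -cmod_gt0; lra.
have [|g gE] := @dlog_cst (- k); first by rewrite oppr_eq0.
have [|h hE] := dlog_near1 (u := dcst (k^-1) * lin 0).
  move=> z Dz; rewrite evM ev_dcst// ev_lin// subr0 cmodM cmodV.
  rewrite mulrC ltr_pdivrMr; last by lra.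
  by rewrite mul1r; exact: le_lt_trans Dz k1.
exists (g + h); rewrite dexpD -gE -hE; apply: ev_inj => z Dz.
rewrite evM evB evM !ev_dcst// ev1// !ev_lin//; by field.
Qed.

End elements.

(** * The stable rank of the disc algebra *)

Section stable_rank.
Variable R : realType.
Local Notation C := R[i].
Local Notation A := (disc_algebra R).
Variable c : A.
Implicit Types (a b : A) (z al : C).

(** [a] is an exponential in the quotient by the ideal generated by [c]. *)
Definition exp_mod a := exists f y : A, a = dexp f + y * c.

Lemma exp_modM a b : exp_mod a -> exp_mod b -> exp_mod (a * b).
Proof.
move=> [f [y ->]] [g [x ->]]; exists (f + g).
by exists (y * dexp g + dexp f * x + y * x * c); rewrite dexpD; ring.
Qed.

Lemma exp_mod_dexp f : exp_mod (dexp f).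
Proof. by exists f, 0; rewrite mul0r addr0. Qed.

Lemma exp_mod_congr a b f y : exp_mod a -> b = dexp f * a + y * c -> exp_mod b.
Proof.
move=> [g [x ->]] ->; exists (f + g), (dexp f * x + y).
by rewrite dexpD; ring.
Qed.

(** Near a boundary point [zeta] with [c zeta <> 0], the quotient [B] of [lin al]
    by a nearby factor [lin al'] with [al'] outside the disc differs from 1 only
    close to [zeta], where [c / c zeta] is close to 1. Hence
    [B + (1 - B) * c / c zeta] is close to 1 on the whole disc. *)
Lemma exp_mod_lin_boundary zeta : cmod zeta = 1 -> ev c zeta != 0 ->
  exists2 t, 0 < t & forall al, cmod (al - zeta) < t -> exp_mod (lin al).
Proof.
move=> z1 cz; set k := (ev c zeta)^-1.
have Dzeta : disc zeta by rewrite /disc/= z1.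
pose w : A := dcst k * c - 1.
have evw z : disc z -> ev w z = k * ev c z - 1.
  by move=> Dz; rewrite evB evM ev_dcst// ev1.
have wz : ev w zeta = 0 by rewrite evw// /k mulVf// subrr.
have [rho rho0 wrho] := (holo_ev w).1 zeta Dzeta (1 / 8) ltac:(lra).
have [K K0 wK] := ev_bounded w.
(* In the product [(1 - B) * w], the factor [w] is small at distance less than
   [rho] from [zeta], and [1 - B] is small elsewhere. *)
pose t := Order.min (rho / 2) (rho / (16 * K)).
have t0 : 0 < t by rewrite lt_min !divr_gt0// mulr_gt0.
have t1 : t <= rho / 2 by rewrite ge_min lexx.
have t2 : t * (16 * K) <= rho.
  by rewrite -ler_pdivlMr ?mulr_gt0// ge_min lexx orbT.
exists t => // al at_.
pose al' := zeta * (1 + t)%:C.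
have al'z : cmod (al' - zeta) = t.
  have -> : al' - zeta = zeta * t%:C by rewrite /al' rmorphD/= rmorph1; ring.
  by rewrite cmodM z1 mul1r cmod_real ger0_norm// ltW.
have al'1 : cmod al' = 1 + t.
  by rewrite cmodM z1 mul1r cmod_real ger0_norm// addr_ge0// ltW.
have [h hE] := lin_outside (k := al') ltac:(lra).
pose B := lin al * dexp (- h).
have [|g gE] := dlog_near1 (u := - ((1 - B) * w)).
  move=> z Dz; have zal' : t <= cmod (z - al').
    by have := cmodB_ge al' z; move: Dz; rewrite cmodB /disc/=; lra.
  have zal'0 : z - al' != 0 by rewrite -cmod_gt0; lra.
  have BE : ev (1 - B) z = (al - al') / (z - al').
    have hz : ev (dexp (- h)) z = (z - al')^-1.
      apply: (mulIf zal'0); rewrite mulVf// -(ev_lin al' Dz) hE -evM dexpN.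
      exact: ev1.
    by rewrite evB evM ev1// hz ev_lin//; field.
  rewrite evN cmodN evM BE cmodM cmodM cmodV.
  have aa : cmod (al - al') <= 2 * t.
    by have := cmod_triangle al zeta al'; rewrite (cmodB zeta); lra.
  have aa0 := cmod_ge0 (al - al').
  have p0 : 0 < cmod (z - al') by lra.
  have [zr|zr] := ltP (cmod (z - zeta)) rho.
    have := wrho z Dz zr; rewrite wz subr0 => wz8.
    rewrite mulrAC ltr_pdivrMr// mul1r.
    have := ler_pM aa0 (cmod_ge0 _) aa (ltW wz8).
    by lra.
  rewrite mulrAC ltr_pdivrMr// mul1r.
  have := ler_pM aa0 (cmod_ge0 _) aa (wK z Dz).
  have := cmod_triangle z al' zeta; rewrite al'z.
  by lra.
apply: (exp_mod_congr (f := h) (y := - dexp h * (1 - B) * dcst k) (exp_mod_dexp g)).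
rewrite -gE /w.
have E : lin al = dexp h * B.
  by rewrite /B mulrCA [dexp h * _]mulrC dexpN mulr1.
by rewrite {1}E; ring.
Qed.

(** Dividing [c] by [lin al] shows that [lin al] is invertible modulo [c], with an
    inverse that controls the neighbouring factors [lin al']. *)
Lemma exp_mod_lin_interior al : cmod al < 1 -> ev c al != 0 ->
  exists2 t, 0 < t & forall al', cmod (al' - al) < t ->
    (exp_mod (lin al) <-> exp_mod (lin al')).
Proof.
move=> al1 cal; have [q0 hq q0E] := holo_division (holo_ev c) al1.
pose q := disc_of hq.
have cE : c = dcst (ev c al) + lin al * q.
  by apply: ev_inj => z Dz; rewrite evD evM ev_dcst// ev_lin// disc_ofE.
have [K K0 qK] := ev_bounded q.
have ca0 : 0 < cmod (ev c al) by rewrite cmod_gt0.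
exists (cmod (ev c al) / K); first by rewrite divr_gt0.
move=> al' al'al; pose kappa := (al - al') / ev c al.
have [|g gE] := dlog_near1 (u := dcst kappa * q).
  move=> z Dz; rewrite evM ev_dcst// /kappa cmodM cmodM cmodV cmodB.
  rewrite mulrAC ltr_pdivrMr// mul1r; apply: le_lt_trans (ler_wpM2l _ (qK z Dz)) _.
    exact: cmod_ge0.
  by rewrite -ltr_pdivlMr.
have E : lin al' = dexp g * lin al + dcst kappa * c.
  rewrite -gE {1}cE; apply: ev_inj => z Dz.
  rewrite !(evD, evN, evM, ev1, ev_dcst, ev_lin)// /kappa; by field.
split=> H; first exact: (exp_mod_congr (f := g) (y := dcst kappa) H).
apply: (exp_mod_congr (f := - g) (y := - dexp (- g) * dcst kappa) H).
rewrite E mulrDr mulrA dexpN mul1r; ring.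
Qed.

(** Otherwise [c], cut off outside the open set of exceptional points [al], would be
    continuous on the closed disc, zero on the circle and nonzero somewhere. *)
Lemma exp_mod_lin al : (disc al -> ev c al != 0) -> exp_mod (lin al).
Proof.
move=> cal; have [Dal|] := boolP (cmod al <= 1); last first.
  by rewrite -ltNge => /lin_outside[g ->]; exact: exp_mod_dexp.
have {}cal := cal Dal; have [cc cd] := holo_ev c.
have on_circle z : cmod z = 1 -> ev c z != 0 -> exp_mod (lin z).
  move=> z1 cz; have [t t0 tP] := exp_mod_lin_boundary z1 cz.
  by apply: tP; rewrite subrr cmod0.
apply: contrapT => Nal.
pose W z := cmod z < 1 /\ ~ exp_mod (lin z).
pose h z := if `[< W z >] then ev c z else 0.
have hW z : W z -> h z = ev c z by rewrite /h => /asboolP ->.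
have hN z : ~ W z -> h z = 0 by rewrite /h => /asboolPn /negbTE ->.
have al1 : cmod al < 1.
  by rewrite lt_neqAle Dal andbT; apply/eqP => al1; exact: Nal (on_circle _ al1 cal).
suff : cmod (h al) <= 0.
  by rewrite hW//; apply/negP; rewrite -ltNge cmod_gt0.
apply: (@maximum_principle _ h [::]) => // z.
- move=> Dz; have [cz|cz] := eqVneq (ev c z) 0.
    have hz : h z = 0 by rewrite /h cz; case: ifP.
    move=> e e0; have [t t0 ct] := cc z Dz e e0; exists t => // w Dw wz.
    rewrite hz subr0 /h; case: asboolP => _; last by rewrite cmod0.
    by have := ct w Dw wz; rewrite cz subr0.
  have [z1|z1] := ltP (cmod z) 1; last first.
    have {}z1 : cmod z = 1 by apply/eqP; rewrite eq_le z1 andbT.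
    have [t t0 tP] := exp_mod_lin_boundary z1 cz.
    move=> e e0; exists t => // w _ wz.
    rewrite !hN ?subr0 ?cmod0// => -[_]; apply.
      exact: on_circle.
    exact: tP.
  have [t t0 tP] := exp_mod_lin_interior z1 cz.
  move=> e e0; have [s s0 cs] := cc z Dz e e0.
  exists (Order.min s (Order.min t (1 - cmod z))).
    by rewrite !lt_min s0 t0 subr_gt0.
  move=> w Dw; rewrite !lt_min => /and3P[ws wt w1].
  have {}w1 : cmod w < 1 by have := cmodB_ge w z; lra.
  have [Nz|Ez] := pselect (exp_mod (lin z)).
    by rewrite !hN ?subr0 ?cmod0// => -[_]; apply => //; exact/(tP w wt).
  rewrite !hW//; first exact: cs.
  by split=> // /(tP w wt).
- move=> z1 hz _; have [Wz|/hN hz0] := pselect (W z); last by rewrite hz0 eqxx in hz.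
  have cz : ev c z != 0 by rewrite hW in hz.
  have [t t0 tP] := exp_mod_lin_interior z1 cz.
  apply: (@near_cderivable _ (ev c) _ z (Order.min t (1 - cmod z))).
  + by rewrite lt_min t0 subr_gt0.
  + move=> w; rewrite lt_min => /andP[wt w1].
    rewrite hW//; split; first by have := cmodB_ge w z; lra.
    by move=> /(tP w wt); case: Wz.
  + exact: cd.
- by move=> z1; rewrite hN ?cmod0// => -[]; rewrite z1 ltxx.
Qed.

Lemma exp_mod_prod (r : seq C) :
  (forall al, al \in r -> disc al -> ev c al != 0) ->
  exists2 b : A, exp_mod b &
    forall z, disc z -> ev b z = (\prod_(x <- r) ('X - x%:P)).[z].
Proof.
elim: r => [_|x r IH rc].
  exists 1 => [|z Dz]; last by rewrite big_nil hornerC ev1.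
  by rewrite -(dexp0 R); exact: exp_mod_dexp.
have [al alr|b bG bE] := IH; first by apply: rc; rewrite inE alr orbT.
exists (lin x * b) => [|z Dz].
  by apply: exp_modM bG; apply: exp_mod_lin; apply: rc; rewrite mem_head.
by rewrite evM ev_lin// bE// big_cons hornerM hornerXsubC.
Qed.

Lemma exp_mod_poly (p : {poly C}) : p != 0 ->
  (forall al, disc al -> root p al -> ev c al != 0) ->
  exists2 b : A, exp_mod b & forall z, disc z -> ev b z = p.[z].
Proof.
move=> p0 pc; have [r pE] := closed_field_poly_normal p.
have l0 : lead_coef p != 0 by rewrite lead_coef_eq0.
have [g gE] := dlog_cst l0.
have [al alr Dal|b bG bE] := @exp_mod_prod r.
  by apply: pc => //; rewrite pE rootZ// root_prod_XsubC.
exists (dexp g * b) => [|z Dz]; first exact: exp_modM (exp_mod_dexp g) bG.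
by rewrite evM -gE ev_dcst// bE// pE hornerZ lead_coefZ (monicP (monic_prod_XsubC _ _ _)) mulr1.
Qed.

(** The stable rank of the disc algebra is one. Modulo [c], an approximation [P] of
    [a] is [a * (1 - (a - P) * d)], since [d] is an inverse of [a] modulo [c], and
    the second factor is close to 1. *)
Lemma exp_mod_unimodular a b d : a * d - b * c = 1 -> exp_mod a.
Proof.
move=> adbc; have [K K0 dK] := ev_bounded d.
have e0 : 0 < 1 / (4 * K) by rewrite divr_gt0// mulr_gt0.
have [p p0 ap] : exists2 p : {poly C}, p != 0 &
    forall z, disc z -> cmod (ev a z - p.[z]) <= 2 * (1 / (4 * K)).
  have [p ap] := polynomial_density (holo_ev a) e0.
  (* If the approximation is zero, a small constant does as well. *)
  have [pE|p0] := eqVneq p 0; last by exists p => // z /ap; lra.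
  exists (1 / (4 * K))%:C%:P.
    by rewrite polyC_eq0 -cmod_gt0 cmod_real normr_gt0 gt_eqF.
  move=> z /ap; rewrite pE !hornerC subr0 => az.
  by apply: le_trans (cmodD_le _ _) _; rewrite cmod_real gtr0_norm//; lra.
have small z : disc z -> cmod ((ev a z - p.[z]) * ev d z) <= 1 / 2.
  move=> Dz; rewrite cmodM; apply: le_trans (ler_pM _ _ (ap z Dz) (dK z Dz)) _;
    rewrite ?cmod_ge0//.
  by rewrite le_eqVlt; apply/orP; left; apply/eqP; field; rewrite lt0r_neq0.
have ev1E z : disc z -> ev a z * ev d z - ev b z * ev c z = 1.
  by move=> Dz; rewrite -!evM -evB adbc ev1.
have [al Dal /eqP pal|P PG PE] := exp_mod_poly p0.
  apply/eqP => cal; have := small al Dal; have := ev1E al Dal.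
  by rewrite pal cal mulr0 !subr0 => ->; rewrite cmod1; lra.
have [|g gE] := dlog_near1 (u := (a - P) * d).
  by move=> z Dz; rewrite evM evB PE//; apply: le_lt_trans (small z Dz) _; lra.
apply: (exp_mod_congr (f := - g) (y := - dexp (- g) * (a - P) * b) PG).
have aE : dexp g * a = P - (a - P) * b * c.
  have ad : a * d = 1 + b * c by rewrite -adbc subrK.
  rewrite -gE (_ : _ * a = a - (a - P) * (a * d)); last by ring.
  by rewrite ad; ring.
rewrite -[LHS]mul1r -(dexpN g) -mulrA aE; ring.
Qed.

End stable_rank.

(** * The matrix exponential *)

Section matrix_exponential.
Variable R : realType.
Local Notation C := R[i].
Local Notation A := (disc_algebra R).
Implicit Types (f g : A) (n k : nat).

Lemma mx_hausdorff (T : topologicalType) m n :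
  hausdorff_space T -> hausdorff_space 'M[T]_(m, n).
Proof.
move=> hT M N MN; apply/matrixP => i j; apply: hT => U V MU NV.
pose lift (W : set T) := [set X : 'M[T]_(m, n) | W (X i j)].
have nlift (X : 'M[T]_(m, n)) W : nbhs (X i j) W -> nbhs X (lift W).
  move=> XW; exists (fun i' j' => if (i' == i) && (j' == j) then W else setT).
    move=> i' j'; case: ifP => [/andP[/eqP-> /eqP->]//|_]; exact: filterT.
  by move=> Y /(_ i j); rewrite !eqxx.
have [X [XU XV]] := MN _ _ (nlift _ _ MU) (nlift _ _ NV).
by exists (X i j).
Qed.

Lemma cmod_le_sup_norm f z : disc z -> cmod (ev f z) <= sup_norm f.
Proof.
move=> /discE Dz; have := sup_norm_ub f (exist _ z Dz).
by rewrite Re_normE disc_fun_ev.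
Qed.

Lemma sup_norm_le_cmod f (M : R) : (forall z, disc z -> cmod (ev f z) <= M) ->
  sup_norm f <= M.
Proof.
move=> fM; apply: sup_norm_le => u; rewrite Re_normE disc_fun_ev.
exact: fM (disc_val u).
Qed.

Lemma sup_norm_ge0 f : 0 <= sup_norm f.
Proof.
apply: le_trans (cmod_le_sup_norm f (_ : disc 0)); first exact: cmod_ge0.
by rewrite /disc/= cmod0.
Qed.

Definition dexp_partial n f : A := \sum_(k < n) dcst k`!%:R^-1 * f ^+ k.

Lemma ev_dexp_partial n f z : disc z ->
  ev (dexp_partial n f) z = exp_partial n (ev f z).
Proof.
move=> Dz; rewrite /dexp_partial /exp_partial.
elim: n => [|n IH]; first by rewrite !big_ord0 ev0.
by rewrite !big_ord_recr /= evD IH evM ev_dcst// evX.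
Qed.

Lemma diag_mxX n (d : 'rV[A]_n.+1) k :
  diag_mx d ^+ k = diag_mx (\row_j d 0 j ^+ k).
Proof.
elim: k => [|k IH].
  rewrite expr0 (_ : \row_j _ = const_mx 1) ?diag_const_mx//.
  by apply/rowP => j; rewrite !mxE.
rewrite exprS IH -[_ * _]/(_ *m _) mulmx_diag; congr diag_mx.
by apply/rowP => j; rewrite !mxE exprS.
Qed.

Lemma partial_exponential n (d : 'rV[A]_n.+1) (P Q : 'M[A]_n.+1) m :
  P *m Q = 1%:M ->
  [series (k`!%:R^-1 : C)%:A *: (P *m diag_mx d *m Q) ^+ k]_k m =
  P *m diag_mx (\row_j dexp_partial m (d 0 j)) *m Q.
Proof.
move=> PQ; have QP := mulmx1C PQ.
have conjX k : (P *m diag_mx d *m Q) ^+ k = P *m diag_mx d ^+ k *m Q.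
  elim: k => [|k IH]; first by rewrite !expr0 mulmx1 PQ.
  rewrite (exprS (diag_mx d)) exprS IH -[LHS]/(_ *m _) -[_ * _]/(_ *m _).
  by rewrite !mulmxA -(mulmxA _ Q P) QP mulmx1.
rewrite seriesEord /=; elim: m => [|m IH].
  rewrite big_ord0 (_ : \row_j _ = 0) ?raddf0 ?mulmx0 ?mul0mx//.
  by apply/rowP => j; rewrite !mxE /dexp_partial big_ord0.
have step : diag_mx (\row_j dexp_partial m (d 0 j)) +
    (m`!%:R^-1 : C)%:A *: diag_mx (\row_j d 0 j ^+ m) =
    diag_mx (\row_j dexp_partial m.+1 (d 0 j)).
  apply/matrixP => i j.
  by rewrite !mxE /dexp_partial big_ord_recr /= mulrnDl mulrnAr dcstE.
by rewrite big_ord_recr /= IH conjX diag_mxX scalemxAl scalemxAr -mulmxDl -mulmxDr step.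
Qed.

(** The partial sums are [P] times a diagonal of partial sums of scalar exponential
    series times [Q], and the latter converge uniformly on the disc. *)
Lemma mexp_diagonalizable n (d : 'rV[A]_n.+1) (P Q : 'M[A]_n.+1) :
  P *m Q = 1%:M ->
  mexp (P *m diag_mx d *m Q) = P *m diag_mx (\row_j dexp (d 0 j)) *m Q.
Proof.
move=> PQ; rewrite /mexp; apply: cvg_lim.
  by apply: mx_hausdorff; exact: norm_hausdorff.
pose L := P *m diag_mx (\row_j dexp (d 0 j)) *m Q; rewrite -/L.
pose M : R := \sum_j sup_norm (d 0 j).
have dM j z : disc z -> cmod (ev (d 0 j) z) <= M.
  move=> Dz; apply: le_trans (cmod_le_sup_norm _ Dz) _.
  by rewrite /M (bigD1 j)//= lerDl sumr_ge0// => *; exact: sup_norm_ge0.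
pose K i j : R := \sum_l sup_norm (P i l) * sup_norm (Q l j).
have K0 i j : 0 <= K i j.
  by rewrite sumr_ge0// => l _; rewrite mulr_ge0 ?sup_norm_ge0.
have bound m i j : sup_norm ((L - P *m diag_mx (\row_j dexp_partial m (d 0 j)) *m Q) i j)
    <= K i j * (expR M * exp_coeff M m).
  apply: sup_norm_le_cmod => z Dz.
  rewrite -mulmxBl -mulmxBr -raddfB mxE /K mulr_suml.
  rewrite ev_sum.
  apply: le_trans (cmod_sum _ _ _) _; apply: ler_sum => l _.
  rewrite mul_mx_diag !mxE !evM !cmodM evB ev_dexp// ev_dexp_partial//.
  rewrite mulrAC.
  apply: ler_pM; rewrite ?mulr_ge0 ?cmod_ge0//.
    by apply: ler_pM; rewrite ?cmod_ge0// cmod_le_sup_norm.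
  apply: le_trans (exp_partial_bound _ _) _.
  rewrite /exp_coeff /= -mulrA; apply: ler_pM; rewrite ?expR_ge0//.
  - by rewrite mulr_ge0 ?invr_ge0 ?exprn_ge0 ?cmod_ge0 ?ler0n.
  - by rewrite ler_expR dM.
  - by rewrite ler_wpM2r ?invr_ge0 ?ler0n// lerXn2r ?nnegrE ?cmod_ge0 ?dM//
      (le_trans (cmod_ge0 _) (dM l z Dz)).
apply/cvg_ballP => -[e e']; rewrite ltcE/= => /andP[/eqP-> e0].
have near_entry i j : \forall m \near \oo, K i j * (expR M * exp_coeff M m) < e.
  have : (exp_coeff M m * (K i j * expR M)) @[m --> \oo] --> (0 * (K i j * expR M) : R).
    apply: cvgMl; apply: cvg_series_cvg_0; exact: is_cvg_series_exp_coeff.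
  rewrite mul0r => /cvgrPdist_lt/(_ e e0); apply: filterS => m.
  rewrite sub0r normrN => /(le_lt_trans (ler_norm _)).
  by rewrite mulrC mulrA.
have near_all : \forall m \near \oo, forall i j, K i j * (expR M * exp_coeff M m) < e.
  by apply: filter_forall => i; apply: filter_forall => j; exact: near_entry.
apply: filterS near_all => m Km.
rewrite partial_exponential//; split; first by rewrite ltcR.
move=> i j; rewrite -ball_normE /ball_/=.
have := le_lt_trans (bound m i j) (Km i j); rewrite -ltcR.
by rewrite [X in (sup_norm X)%:C]mxE [X in (sup_norm (_ + X))%:C]mxE.
Qed.

End matrix_exponential.

(** * Two exponentials *)

Section two_by_two.
Variable S : comNzRingType.
Implicit Types a b c d : S.

Definition mx2 a b c d : 'M[S]_2 :=
  \matrix_(i, j) if i == 0 then (if j == 0 then a else b)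
                 else (if j == 0 then c else d).

Lemma mx2E (M : 'M[S]_2) : M = mx2 (M 0 0) (M 0 1) (M 1 0) (M 1 1).
Proof.
by apply/matrixP => -[[|[|//]] i2] [[|[|//]] j2]; rewrite !mxE /=;
  congr (M _ _); exact: val_inj.
Qed.

Lemma mx2M a b c d a' b' c' d' : mx2 a b c d *m mx2 a' b' c' d' =
  mx2 (a * a' + b * c') (a * b' + b * d') (c * a' + d * c') (c * b' + d * d').
Proof.
by rewrite [LHS]mx2E !mxE !big_ord_recl !big_ord0 !mxE /= !addr0.
Qed.

Lemma mx2_1 : mx2 1 0 0 1 = 1%:M.
Proof. by rewrite [RHS]mx2E !mxE. Qed.

Lemma det_mx2 (M : 'M[S]_2) : \det M = M 0 0 * M 1 1 - M 0 1 * M 1 0.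
Proof.
rewrite (expand_det_row M 0) !big_ord_recl big_ord0 addr0 /cofactor !det_mx11 !mxE /=.
rewrite /bump /= !addn0 add0n expr0 expr1 mul1r mulN1r mulrN.
by congr (_ * M _ _ - M _ _ * M _ _); exact: val_inj.
Qed.

Definition row2 a b : 'rV[S]_2 := \row_j if j == 0 then a else b.

Lemma diag_row2 a b : diag_mx (row2 a b) = mx2 a 0 0 b.
Proof. by rewrite [LHS]mx2E !mxE. Qed.

Lemma mxtrace_row2 a b : \tr (diag_mx (row2 a b)) = a + b.
Proof. by rewrite mxtrace_diag !big_ord_recl big_ord0 !mxE /= addr0. Qed.

Lemma mx2_eq a b c d a' b' c' d' : a = a' -> b = b' -> c = c' -> d = d' ->
  mx2 a b c d = mx2 a' b' c' d'.
Proof. by move=> -> -> -> ->. Qed.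

Lemma shear_upperK x : mx2 1 x 0 1 *m mx2 1 (- x) 0 1 = 1%:M.
Proof. by rewrite mx2M -mx2_1; apply: mx2_eq; ring. Qed.

Lemma shear_lowerK x : mx2 1 0 x 1 *m mx2 1 0 (- x) 1 = 1%:M.
Proof. by rewrite mx2M -mx2_1; apply: mx2_eq; ring. Qed.

Lemma shear_lower_diag x a d : mx2 1 0 x 1 *m mx2 a 0 0 d *m mx2 1 0 (- x) 1 =
  mx2 a 0 ((a - d) * x) d.
Proof. by rewrite !mx2M; apply: mx2_eq; ring. Qed.

Lemma shear_upper_diag x a d : mx2 1 (- x) 0 1 *m mx2 a 0 0 d *m mx2 1 x 0 1 =
  mx2 a ((a - d) * x) 0 d.
Proof. by rewrite !mx2M; apply: mx2_eq; ring. Qed.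

Lemma conj_mulmx (P Q X Y : 'M[S]_2) : Q *m P = 1%:M ->
  P *m (X *m Y) *m Q = P *m X *m Q *m (P *m Y *m Q).
Proof. by move=> QP; rewrite !mulmxA -(mulmxA _ Q P) QP mulmx1. Qed.

(** Conjugation by a shear moves the unit [u = M 0 0 - y * M 1 0] into the upper left
    corner. After that comes an LU factorization in which the diagonal is shared
    out between the factors, [t] to the first one and [u / t] to the second. *)
Lemma triangular_factorization (M : 'M[S]_2) u v y t t' :
  \det M = 1 -> M 0 0 = u + y * M 1 0 -> v * u = 1 -> t' * t = 1 ->
  let b := u * y + M 0 1 - y * M 1 1 in
  M = mx2 1 y 0 1 *m (mx2 t 0 (M 1 0 * v * t) t' *m
                      mx2 (u * t') (t' * b) 0 (v * t)) *m mx2 1 (- y) 0 1.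
Proof.
rewrite det_mx2 => det1 uE vu tt b.
set c := M 1 0 in det1 uE b *; set d := M 1 1 in det1 b *.
have dE : v * (1 + b * c) = c * y + d.
  have -> : 1 + b * c = u * (c * y + d) by rewrite -det1 uE /b; ring.
  by rewrite mulrA vu mul1r.
have -> : mx2 t 0 (c * v * t) t' *m mx2 (u * t') (t' * b) 0 (v * t) =
    mx2 u b c (c * y + d).
  rewrite mx2M -dE; apply: mx2_eq.
  - by transitivity ((t' * t) * u); [ring|rewrite tt mul1r].
  - by transitivity ((t' * t) * b); [ring|rewrite tt mul1r].
  - by transitivity (c * (v * u) * (t' * t)); [ring|rewrite tt vu !mulr1].
  - transitivity ((t' * t) * (v * (1 + b * c))); first by ring.
    by rewrite tt mul1r.
by rewrite !mx2M [LHS]mx2E uE -/c -/d; apply: mx2_eq; rewrite /b; ring.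
Qed.

End two_by_two.

Section two_exponentials.
Variable R : realType.
Local Notation A := (disc_algebra R).
Implicit Types (f g x y : A).

Lemma mexp_conj_diag (P Q : 'M[A]_2) g : P *m Q = 1%:M ->
  exists2 B : 'M[A]_2, \tr B = 0 &
    mexp B = P *m mx2 (dexp g) 0 0 (dexp (- g)) *m Q.
Proof.
move=> PQ; exists (P *m diag_mx (row2 g (- g)) *m Q).
  by rewrite -mulmxA mxtrace_mulC -mulmxA (mulmx1C PQ) mulmx1 mxtrace_row2 subrr.
have E : \row_j dexp (row2 g (- g) 0 j) = row2 (dexp g) (dexp (- g)).
  by apply/rowP => j; rewrite !mxE; case: ifP.
by rewrite (mexp_diagonalizable _ PQ) E diag_row2.
Qed.

Lemma eigenvalue_gap g : (forall z, disc z -> complex.Re (ev g z) != 0) ->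
  exists w, (dexp g - dexp (- g)) * w = 1.
Proof.
move=> g0; apply: dinv_exists => z Dz; rewrite evB !ev_dexp// evN subr_eq0.
apply/eqP => /(congr1 (@cmod R)); rewrite !cmod_cexp ReN => /expR_inj.
by have /eqP := g0 z Dz; lra.
Qed.

(** A triangular matrix with diagonal [dexp g], [dexp (- g)] is diagonalizable over
    the disc algebra as soon as the difference of its eigenvalues is a unit. *)
Lemma mexp_conj_lower (P Q : 'M[A]_2) g x : P *m Q = 1%:M ->
  (forall z, disc z -> complex.Re (ev g z) != 0) ->
  exists2 B : 'M[A]_2, \tr B = 0 &
    mexp B = P *m mx2 (dexp g) 0 x (dexp (- g)) *m Q.
Proof.
move=> PQ /eigenvalue_gap[w wE]; pose p := w * x.
have PNQ : P *m mx2 1 0 p 1 *m (mx2 1 0 (- p) 1 *m Q) = 1%:M.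
  by rewrite mulmxA -(mulmxA P) shear_lowerK mulmx1.
have [B trB BE] := mexp_conj_diag g PNQ; exists B => //.
have := shear_lower_diag p (dexp g) (dexp (- g)).
rewrite /p [X in _ = mx2 _ _ X _]mulrA wE mul1r => <-.
by rewrite BE !mulmxA.
Qed.

Lemma mexp_conj_upper (P Q : 'M[A]_2) g x : P *m Q = 1%:M ->
  (forall z, disc z -> complex.Re (ev g z) != 0) ->
  exists2 B : 'M[A]_2, \tr B = 0 &
    mexp B = P *m mx2 (dexp g) x 0 (dexp (- g)) *m Q.
Proof.
move=> PQ /eigenvalue_gap[w wE]; pose p := w * x.
have NN : mx2 1 (- p) 0 1 *m mx2 1 p 0 1 = 1%:M.
  by apply: mulmx1C; exact: shear_upperK.
have PNQ : P *m mx2 1 (- p) 0 1 *m (mx2 1 p 0 1 *m Q) = 1%:M.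
  by rewrite mulmxA -(mulmxA P) NN mulmx1.
have [B trB BE] := mexp_conj_diag g PNQ; exists B => //.
have := shear_upper_diag p (dexp g) (dexp (- g)).
rewrite /p [X in _ = mx2 _ X _ _]mulrA wE mul1r => <-.
by rewrite BE !mulmxA.
Qed.

End two_exponentials.

Theorem theorem2 (R : realType) (A : 'M[disc_algebra R]_2) :
  \det A = 1 ->
  exists B C : 'M[disc_algebra R]_2,
    [/\ \tr B = 0, \tr C = 0 & A = mexp B *m mexp C].
Proof.
move=> det1; have := det1; rewrite det_mx2 => /exp_mod_unimodular[f [y aE]].
have [M M0 fM] := ev_bounded f.
pose tau := dcst (M + 1)%:C : disc_algebra R.
(* [tau] is positive and exceeds the real part of [f], so that neither exponent
   [tau], [f - tau] takes imaginary values. *)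
have tau0 z : disc z -> complex.Re (ev tau z) != 0.
  by move=> Dz; rewrite ev_dcst//=; apply/eqP; lra.
have ftau0 z : disc z -> complex.Re (ev (f - tau) z) != 0.
  move=> Dz; rewrite evB ev_dcst// ReB /=.
  by have := le_trans (Re_cmod _) (fM z Dz) => fz; apply/eqP; lra.
have := triangular_factorization det1 aE (dexpN f) (dexpN tau).
set b := _ + _ - _; move=> /= AE.
have [B trB BE] := mexp_conj_lower (A 1 0 * dexp (- f) * dexp tau)
  (shear_upperK y) tau0.
have [C trC CE] := mexp_conj_upper (dexp (- tau) * b) (shear_upperK y) ftau0.
have fE : dexp (f - tau) = dexp f * dexp (- tau) := dexpD f (- tau).
have fNE : dexp (- (f - tau)) = dexp (- f) * dexp tau.
  by rewrite opprB addrC dexpD.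
exists B, C; split; [exact: trB|exact: trC|].
rewrite BE CE fE fNE -(conj_mulmx _ _ (mulmx1C (shear_upperK y))).
exact: AE.
Qed.
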